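(* Let $n,k$ be positive integers such that $n\ge k+3$ and $k\equiv 2\pmod 3$. Let $$x_1=k\cdot 3^{(n-k-1)/3-1}+\tfrac13(k+1),\qquad x_2=(k+1)\cdot 3^{(n-k-1)/3-1}+1,$$ $$x_3=k\cdot 3^{(n-k)/3-1}+\tfrac13(k+1)\left[\tfrac13(n-k)+1\right]+1,\qquad x_4=(k+1)\cdot 3^{(n-k)/3-1}+\tfrac13(n+k-1).$$ If $G\in\mathcal{P}(n,k)$, then $$m(G)\le\begin{cases}\max\{x_1,x_2\}, & \text{if } n\equiv 0\pmod 3;\\ (k+1)\cdot 3^{(n-k-2)/3-1}, & \text{if } n\equiv 1\pmod 3;\\ \max\{x_3,x_4\}, & \text{if } n\equiv 2\pmod 3.\end{cases}$$ Moreover, equality holds if and only if one of the following statements holds: (i) $n\equiv 0\pmod 3$, and for some $i\in\{1,2\}$, $G\in\mathcal{H}_i$ and $x_i=\max\{x_1,x_2\}$, where $\mathcal{H}_1=\mathcal{G}_2$ and $\mathcal{H}_2=\mathcal{G}_9$; (ii) $n\equiv 1\pmod 3$ and $G\in\mathcal{G}_6\cup\mathcal{G}_7$; (iii) $n\equiv 2\pmod 3$, and for some $i\in\{3,4\}$, $G\in\mathcal{H}_i$ and $x_i=\max\{x_3,x_4\}$, where $\mathcal{H}_3=\mathcal{G}_1$ and $\mathcal{H}_4=\mathcal{G}_8$.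
   Context: All graphs are finite, simple and undirected. A dissociation set of a graph $G$ is a subset of $V(G)$ inducing a subgraph of maximum degree at most $1$; a maximum dissociation set is one of maximum cardinality; $m(G)$ is the number of maximum dissociation sets of $G$. A unicyclic graph is a connected graph with exactly one cycle. A potted graph is a unicyclic graph whose cycle contains a unique vertex of degree larger than $2$. $\mathcal{P}(n,k)$ is the set of potted graphs of order $n$ whose cycle has order $k$. $P_j$ and $C_j$ are the path and cycle of order $j$. For vertex-disjoint trees $T_1,\dots,T_r$, $G_w(T_1,\dots,T_r)$ denotes a graph obtained from $T_1\cup\dots\cup T_r$ by choosing one leaf from each $T_i$ and identifying these $r$ leaves into a single vertex $w$. $C_k+_eG_w(T_1,\dots,T_r)$ is obtained from the disjoint union of $C_k$ and $G_w(T_1,\dots,T_r)$ by adding an edge between $w$ and a vertex of $C_k$; $C_k\odot G_w(T_1,\dots,T_r)$ is obtained by identifying $w$ with a vertex of $C_k$. Families (below $l\ge1$ and each $T_i$ is $P_4$ or $K_{1,3}$, independently): $\mathcal{T}_1=\{P_3,\ G_w(P_3,P_4,\dots,P_4)\}$ (one $P_3$ and one or more copies of $P_4$; for the tree $P_3$ itself, $w$ is an end vertex); $\mathcal{T}_2=\{G_w(P_2,P_3),\ G_w(P_2,P_3,T_1,\dots,T_l)\}$; $\mathcal{G}_j=\{C_k+_eT: T\in\mathcal{T}_j\}$ for $j=1,2$ (the edge is attached at $w$); $\mathcal{G}_6=\{C_k\odot G_w(P_3,T_1,\dots,T_l)\}$; $\mathcal{G}_7=\{C_k\odot G_w(P_2,P_2,T_1,\dots,T_l)\}$;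 $\mathcal{G}_8=\{C_k\odot G_w(P_4,\dots,P_4)\}$ (one or more copies of $P_4$); $\mathcal{G}_9=\{C_k\odot G_w(P_2,T_1,\dots,T_l)\}$. Membership is up to isomorphism. *)

(* Defs.v *)
From mathcomp Require Import all_boot.
From Stdlib Require List.

Set Implicit Arguments.
Unset Strict Implicit.
Unset Printing Implicit Defensive.

Record sgraph := SGraph {
  svertex :> finType;
  sedge : rel svertex;
  sedge_sym : symmetric sedge;
  sedge_irrefl : irreflexive sedge }.
Arguments sedge {s}.

Notation "x -- y" := (sedge x y) (at level 30).

Definition isomorphic (G H : sgraph) : Prop :=
  exists f : G -> H, bijective f /\ forall x y : G, f x -- f y = x -- y.

Definition degree (G : sgraph) (x : G) : nat := #|[set y | x -- y]|.

Definition leaf (G : sgraph) (x : G) : bool := degree x == 1.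

Definition connected (G : sgraph) : Prop := forall x y : G, connect sedge x y.

Definition dissociation (G : sgraph) (S : {set G}) : bool :=
  [forall x in S, #|[set y in S | x -- y]| <= 1].

Definition max_dissociation (G : sgraph) (S : {set G}) : bool :=
  dissociation S && [forall S' : {set G}, dissociation S' ==> (#|S'| <= #|S|)].

Definition num_max_dissociation (G : sgraph) : nat :=
  #|[set S : {set G} | max_dissociation S]|.

(* A cycle of G is a subgraph, represented by its edge set, so that cyclic
   vertex sequences differing by a rotation or a reversal give the same cycle;
   its vertex set is [cover C]. *)
Definition is_cycle (G : sgraph) (C : {set {set G}}) : Prop :=
  exists c : seq G,
    [/\ ucycle sedge c, 2 < size c & C = [set [set x; next c x] | x in c]].

Definition unicyclic (G : sgraph) : Prop :=
  connected G /\ exists! C : {set {set G}}, is_cycle C.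

Definition potted (G : sgraph) : Prop :=
  unicyclic G /\
  forall C : {set {set G}}, is_cycle C ->
    exists! v : G, v \in cover C /\ 2 < degree v.

Definition potted_order (n k : nat) (G : sgraph) : Prop :=
  [/\ potted G, #|G| = n
    & forall C : {set {set G}}, is_cycle C -> #|cover C| = k].

Section StandardGraphs.
Variables j a b : nat.

Definition path_rel : rel 'I_j := fun x y => (x.+1 == y) || (y.+1 == x).

Lemma path_rel_sym : symmetric path_rel.
Proof. by move=> x y; rewrite /path_rel orbC. Qed.

Lemma path_rel_irrefl : irreflexive path_rel.
Proof. by move=> x; rewrite /path_rel orbb eqn_leq ltnn. Qed.

Definition path_graph := SGraph path_rel_sym path_rel_irrefl.

Definition cycle_rel : rel 'I_j := fun x y =>
  (x != y) && ((x.+1 == y %[mod j]) || (y.+1 == x %[mod j])).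

Lemma cycle_rel_sym : symmetric cycle_rel.
Proof. by move=> x y; rewrite /cycle_rel eq_sym orbC. Qed.

Lemma cycle_rel_irrefl : irreflexive cycle_rel.
Proof. by move=> x; rewrite /cycle_rel eqxx. Qed.

(* This is C_j only for j >= 3. *)
Definition cycle_graph := SGraph cycle_rel_sym cycle_rel_irrefl.

Definition bipartite_rel : rel ('I_a + 'I_b) := fun x y =>
  match x, y with inl _, inr _ | inr _, inl _ => true | _, _ => false end.

Lemma bipartite_rel_sym : symmetric bipartite_rel.
Proof. by case=> x [y|y]. Qed.

Lemma bipartite_rel_irrefl : irreflexive bipartite_rel.
Proof. by case. Qed.

Definition complete_bipartite := SGraph bipartite_rel_sym bipartite_rel_irrefl.

End StandardGraphs.

Record pgraph := PGraph { pg_graph :> sgraph; point : pg_graph }.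

Section Operations.
Variables (G : sgraph) (u : G) (H : sgraph) (v : H).

(* Disjoint union of G and H with u and v identified: the vertex v of H is
   dropped, and u takes over its neighbours. *)
Definition glue_rel : rel (G + {y : H | y != v}) := fun a b =>
  match a, b with
  | inl x, inl y => x -- y
  | inr x, inr y => val x -- val y
  | inl x, inr y | inr y, inl x => (x == u) && (v -- val y)
  end.

Lemma glue_rel_sym : symmetric glue_rel.
Proof. by case=> x [y|y] //=; rewrite sedge_sym. Qed.

Lemma glue_rel_irrefl : irreflexive glue_rel.
Proof. by case=> x /=; rewrite sedge_irrefl. Qed.

Definition glue : pgraph :=
  @PGraph (SGraph glue_rel_sym glue_rel_irrefl) (inl u).

(* Disjoint union of G and H plus the edge uv. *)
Definition link_rel : rel (G + H) := fun a b =>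
  match a, b with
  | inl x, inl y => x -- y
  | inr x, inr y => x -- y
  | inl x, inr y | inr y, inl x => (x == u) && (y == v)
  end.

Lemma link_rel_sym : symmetric link_rel.
Proof. by case=> x [y|y] //=; rewrite sedge_sym. Qed.

Lemma link_rel_irrefl : irreflexive link_rel.
Proof. by case=> x /=; rewrite sedge_irrefl. Qed.

Definition link : sgraph := SGraph link_rel_sym link_rel_irrefl.

End Operations.

(* [Gw Ts p]: p is a graph G_w(T_1, ..., T_r) pointed at w, for some choice of
   a leaf in each T_i.  The trees are glued one by one onto the one-vertex
   graph, whose vertex becomes w. *)
Inductive Gw : seq sgraph -> pgraph -> Prop :=
| Gw_nil : Gw [::] (@PGraph (path_graph 1) ord0)
| Gw_cons (T : sgraph) (x : T) (Ts : seq sgraph) (p : pgraph) :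
    leaf x -> Gw Ts p -> Gw (T :: Ts) (glue x (point p)).

Notation P_ j := (path_graph j) (only parsing).

(* T_1, ..., T_l with l >= 1, each T_i being P_4 or K_{1,3}. *)
Definition P4_K13_seq (Ts : seq sgraph) : Prop :=
  0 < size Ts /\
  List.Forall (fun T => T = P_ 4 \/ T = complete_bipartite 1 3) Ts.

Definition tree_family1 (p : pgraph) : Prop :=
  (exists2 x : P_ 3, leaf x & p = PGraph x) \/
  (exists2 s, 0 < s & Gw (P_ 3 :: nseq s (P_ 4)) p).

Definition tree_family2 (p : pgraph) : Prop :=
  Gw [:: P_ 2; P_ 3] p \/
  (exists2 Ts, P4_K13_seq Ts & Gw [:: P_ 2, P_ 3 & Ts] p).

Definition is_cycle_link (k : nat) (p : pgraph) (G : sgraph) : Prop :=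
  exists c : cycle_graph k, isomorphic G (link c (point p)).

Definition is_cycle_glue (k : nat) (p : pgraph) (G : sgraph) : Prop :=
  exists c : cycle_graph k, isomorphic G (glue c (point p)).

Definition family_G1 (k : nat) (G : sgraph) : Prop :=
  exists2 p, tree_family1 p & is_cycle_link k p G.

Definition family_G2 (k : nat) (G : sgraph) : Prop :=
  exists2 p, tree_family2 p & is_cycle_link k p G.

Definition family_G6 (k : nat) (G : sgraph) : Prop :=
  exists Ts p, [/\ P4_K13_seq Ts, Gw (P_ 3 :: Ts) p & is_cycle_glue k p G].

Definition family_G7 (k : nat) (G : sgraph) : Prop :=
  exists Ts p,
    [/\ P4_K13_seq Ts, Gw [:: P_ 2, P_ 2 & Ts] p & is_cycle_glue k p G].

Definition family_G8 (k : nat) (G : sgraph) : Prop :=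
  exists s p, [/\ 0 < s, Gw (nseq s (P_ 4)) p & is_cycle_glue k p G].

Definition family_G9 (k : nat) (G : sgraph) : Prop :=
  exists Ts p, [/\ P4_K13_seq Ts, Gw (P_ 2 :: Ts) p & is_cycle_glue k p G].

(* For k = 2 mod 3 and n >= k + 3, all divisions by 3 are exact and all
   subtractions are nonnegative in x1, x2 when n = 0 mod 3, and in x3, x4 when
   n = 2 mod 3; they are only meaningful then. *)
Definition x1 (n k : nat) : nat :=
  k * 3 ^ ((n - k - 1) %/ 3 - 1) + (k + 1) %/ 3.

Definition x2 (n k : nat) : nat :=
  (k + 1) * 3 ^ ((n - k - 1) %/ 3 - 1) + 1.

Definition x3 (n k : nat) : nat :=
  k * 3 ^ ((n - k) %/ 3 - 1) + (k + 1) %/ 3 * ((n - k) %/ 3 + 1) + 1.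

Definition x4 (n k : nat) : nat :=
  (k + 1) * 3 ^ ((n - k) %/ 3 - 1) + (n + k - 1) %/ 3.

Definition dissociation_bound (n k : nat) : nat :=
  match n %% 3 with
  | 0 => maxn (x1 n k) (x2 n k)
  | 1 => (k + 1) * 3 ^ ((n - k - 2) %/ 3 - 1)
  | _ => maxn (x3 n k) (x4 n k)
  end.

(* Main.v *)
Require Import Defs.
From mathcomp Require Import all_boot.
From mathcomp Require Import all_order all_algebra zify.
From Stdlib Require Import Permutation.

Set Implicit Arguments.
Unset Strict Implicit.
Unset Printing Implicit Defensive.

(* A potted graph is a cycle with rooted trees hung at one vertex w of it. Sort
   the dissociation sets of a graph pointed at a vertex according to the state of
   that vertex: outside the set, isolated in it, or matched to a neighbour.
   Hanging a tree acts on the numbers of sets of the largest sizes in each state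
   by the product rule [pjoin], and the cycle of length k = 3t + 2 contributes
   t + 1, 1 and 2t sets, all of the same size. Hence, if M, Z and Y count the
   maximum dissociation sets of the forest obtained by deleting the cycle that
   are arbitrary, that avoid all roots, and that contain exactly one root, which
   is isolated, then m(G) = (t + 1) M + (2t + 1) Z + Y.

   A tree of order n > 3 has at most (2/3) 3^floor(n/3) maximum dissociation
   sets, so such a tree in the forest costs a third of M. Only Z can compensate for this,
   and Z is large enough only when the forest is a single tree all of whose
   branches have order at most 3. There remain this case and the case where all
   trees of the forest have order at most 3, in both of which the numbers are
   explicit. *)

(** * Profiles of rooted trees *)

(** The formula for m(G) sorts the sets by the state of the cycle vertex w. If w is outside, the
    forest is free: (t + 1) M. If w is isolated or matched along the cycle, all roots are avoided:
    (1 + 2t) Z. If w is matched to a root, that root is isolated in its tree and the other roots are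
    avoided: Y. No sizes need to be tracked at w: for k = 2 mod 3 the cycle has kind [Level], and
    [pjoin] with a first argument of kind [Level] is again of kind [Level]. [Join X Y] hangs Y at
    the root of X, so that the product rule is a structural recursion. The price is an order on the
    children, which matters only up to isomorphism; hence the use of [Permutation]. A bound on the
    total number alone does not propagate, because [pjoin] mixes the three counts and treats the
    kinds differently. The invariant is therefore a system of inequalities for each kind, with the
    small trees set apart, that is closed under the nine cases of [pjoin]; each case is then left to
    arithmetic. The scale is 3 to the [height] rather than to floor(n/3), since its carry depends on
    the kinds alone. *)

Inductive rtree := Root | Join of rtree & rtree.

Inductive kind := Level | Paired | Alone.

(* For a graph pointed at w, let d be the largest size of a dissociation set
   avoiding w. The profile counts the dissociation sets that avoid w ([pout]),
   that contain w as an isolated vertex of the induced graph ([pisol]), and that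
   contain w with a neighbour ([pmatch]), at the respective sizes (d, d, d) for
   the kind [Level], (d, d, d + 1) for [Paired] and (d, d + 1, d + 1) for [Alone];
   no set of the given sort is larger. Smaller sets never matter. *)
Record profile := Profile { pkind : kind; pout : nat; pisol : nat; pmatch : nat }.

Definition ptotal p :=
  match pkind p with
  | Level => pout p + pisol p + pmatch p
  | Paired => pmatch p
  | Alone => pisol p + pmatch p
  end.

(* Adding an edge between the points: a dissociation set containing both of them
   has each of them isolated on its own side. *)
Definition pjoin p q :=
  let a := pout p * ptotal q in
  let b := pisol p * pout q in
  let c := pmatch p * pout q in
  let d := pisol p * pisol q in
  match pkind p, pkind q with
  | Level, Level => Profile Level a b (c + d)
  | Paired, Level => Profile Paired a b c
  | Alone, Level => Profile Alone a b (c + d)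
  | Level, Paired => Profile Level a 0 0
  | Paired, Paired => Profile Level a 0 c
  | Alone, Paired => Profile Level a b (c + d)
  | Level, Alone => Profile Level a 0 d
  | Paired, Alone => Profile Level a 0 (c + d)
  | Alone, Alone => Profile Paired a b d
  end.

Fixpoint prof T :=
  if T is Join X Y then pjoin (prof X) (prof Y) else Profile Alone 1 1 0.

Fixpoint order T := if T is Join X Y then order X + order Y else 1.

Definition carry p q :=
  match pkind p, pkind q with
  | Paired, Paired | Alone, Paired | Paired, Alone => 1
  | _, _ => 0
  end.

(* [3 ^ height T] is the scale of the numbers in [prof T]. By [prof_bounds] below,
   3 * height T + r <= order T where r = 0, 2, 1 for the kinds [Level], [Paired]
   and [Alone]; a join carries when these remainders add up to at least 3. *)
Fixpoint height T :=
  if T is Join X Y then height X + height Y + carry (prof X) (prof Y) else 0.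

(* The paths on 2 and 3 vertices rooted at an end, and the path on 3 vertices
   rooted at its centre: what is left of P_3, P_4 and K_{1,3} when a leaf is
   removed and the tree is rooted at the neighbour of that leaf. *)
Notation P2 := (Join Root Root).
Notation P3e := (Join Root P2).
Notation P3c := (Join P2 Root).

(* In the lemmas on [profile_bounds], P stands for 3 ^ e; this is all that is needed
   about powers of 3. *)
Definition pow_case e P := e = 0 /\ P = 1 \/ e = 1 /\ P = 3 \/ 1 < e /\ 9 <= P.

(* The small trees are listed exactly, since the general inequalities fail for them. *)
Definition profile_bounds n e P p :=
  let: Profile k A b c := p in
  match k with
  | Level => 3 * e <= n /\ (n = 3 /\ P = 3 /\ A = 1 /\ b + c = 2 /\ b <= 1 \/
       [/\ 4 <= n, 3 <= P, 3 * A <= P, 3 * b <= P & 3 * (A + b + c) <= 2 * P] /\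
       (P < 9 \/ 9 * (A + b) <= 4 * P))
  | Paired => 3 * e + 2 <= n /\ (n = 2 /\ P = 1 /\ A = 1 /\ b = 1 /\ c = 1 \/
       [/\ 5 <= n, 3 <= P, 3 * c <= P & A <= P /\ 3 * b <= P \/ 3 * A <= 2 * P /\ b <= P ])
  | Alone => 3 * e + 1 <= n /\ (n = 1 /\ P = 1 /\ A = 1 /\ b = 1 /\ c = 0 \/
       [/\ 4 <= n, 3 <= P, A <= P, 3 * b <= P & 3 * c <= P] /\
       (P < 9 \/ 9 * (b + c) <= 4 * P) /\ (P <> 3 \/ A <= 2 \/ n = 4))
  end.

Ltac split_hyps := repeat match goal with
  | H : _ /\ _ |- _ => destruct H
  | H : _ \/ _ |- _ => destruct H
  | H : and3 _ _ _ |- _ => destruct H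
  | H : and4 _ _ _ _ |- _ => destruct H
  | H : and5 _ _ _ _ _ |- _ => destruct H
  end.

Ltac split_goal := repeat match goal with
  | |- _ /\ _ => split
  | |- [/\ _, _, _, _ & _] => split
  | |- [/\ _, _, _ & _] => split
  | |- _ -> _ => intro
  end.

(** The induction step of [prof_bounds], stated for arbitrary numbers instead of trees, so that each
    pair of kinds becomes a goal of polynomial arithmetic in which products of two bounds
    suffice. *)
Lemma pjoin_bounds n e P p m f Q q : pow_case e P -> pow_case f Q ->
  profile_bounds n e P p -> profile_bounds m f Q q ->
  profile_bounds (n + m) (e + f + carry p q) (P * Q * 3 ^ carry p q) (pjoin p q).
Proof.
case: p => kX A b c; case: q => kY A' b' c' HP HQ.
rewrite /profile_bounds /pow_case in HP HQ *.
case: kX; case: kY; rewrite /pjoin /carry /ptotal /= ?addn0 ?add0n ?expn0 ?expn1 ?muln1;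
  move=> [He HX] [Hf HY]; (split; [clear -He Hf; lia|]).
all: split_hyps; subst; try (exfalso; lia); try lia; try (left; lia);
  right; split_goal; try lia; nia.
Qed.

Lemma pow_caseP e : pow_case e (3 ^ e).
Proof.
case: e => [|[|e]]; [by left|by right; left|right; right].
by rewrite !expnS mulnA leq_pmulr // expn_gt0.
Qed.

Lemma prof_bounds T : profile_bounds (order T) (height T) (3 ^ height T) (prof T).
Proof.
elim: T => [|X IHX Y IHY]; first by split=> //; left.
by rewrite /= !expnD; apply: pjoin_bounds => //; apply: pow_caseP.
Qed.

Fixpoint has_big T := if T is Join X Y then has_big X || (4 <= order Y) else false.

(* A child subtree with more than 3 vertices costs a factor 2/3 at least. The
   last alternative for [Paired] is due to the path on 5 vertices rooted at an end. *)
Definition profile_big_bounds n P p :=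
  let: Profile k A b c := p in
  match k return Prop with
  | Level => 9 * A <= 2 * P
  | Paired => 3 * A <= 2 * P /\ 3 * b <= P \/ [/\ 9 <= P, 9 * A <= 4 * P & b <= P] \/
            [/\ P = 3, A <= 2, b <= 3 & c <= 1] /\ (b <= 2 \/ n = 5)
  | Alone => 3 * A <= 2 * P
  end.

(** The last hypothesis mirrors the recursion of [has_big]: either the child being hung is big, or a
    big child was hung at the root earlier and its loss is inherited. *)
Lemma pjoin_big n e P p m f Q q : pow_case e P -> pow_case f Q ->
  profile_bounds n e P p -> profile_bounds m f Q q ->
  4 <= m \/ profile_big_bounds n P p ->
  profile_big_bounds (n + m) (P * Q * 3 ^ carry p q) (pjoin p q).
Proof.
case: p => kX A b c; case: q => kY A' b' c' HP HQ.
rewrite /profile_bounds /profile_big_bounds /pow_case in HP HQ *.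
case: kX; case: kY; rewrite /pjoin /carry /ptotal /= ?addn0 ?expn0 ?expn1 ?muln1;
  move=> [He HX] [Hf HY] HB; clear HP.
all: split_hyps; subst; try (exfalso; lia); try lia; try (left; split; lia);
  try (right; left; split; lia); try (right; right; split; [split; lia|lia]);
  try (left; split; nia); nia.
Qed.

(* With a, b, c the profile of the only tree hung at the cycle of length
   3 * t + 2, the number of maximum dissociation sets is t * U + V. *)
Lemma pjoin_big_weight n e P p m f Q q : pow_case e P -> pow_case f Q ->
  profile_bounds n e P p -> profile_bounds m f Q q ->
  4 <= m \/ profile_big_bounds n P p ->
  let: Profile k a b c := pjoin p q in
  let R := P * Q * 3 ^ carry p q in
  let U := 3 * a + b + c in let V := 2 * a + 2 * b + c in
  k = Level -> U <= R /\ U + V < 2 * R \/ [/\ n + m = 6, U <= 10 & V <= 8].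
Proof.
case: p => kX A b c; case: q => kY A' b' c' HP HQ.
rewrite /profile_bounds /profile_big_bounds /pow_case in HP HQ *.
case: kX; case: kY; rewrite /pjoin /carry /ptotal /= ?addn0 ?expn0 ?expn1 ?muln1;
  move=> [He HX] [Hf HY] HB // _; clear HP.
all: split_hyps; subst; try (exfalso; lia); try (left; lia); try (right; split; lia);
  try (left; split; nia).
Qed.

(** * Forests hung at a vertex, and trees of order at most 3 *)

Definition pjoins p L := foldr (fun T q => pjoin q (prof T)) p L.
Fixpoint children T := if T is Join X Y then Y :: children X else [::].
Definition orders L := sumn (map order L).

Lemma prof_children T : prof T = pjoins (Profile Alone 1 1 0) (children T).
Proof. by elim: T => //= X IHX Y _; rewrite -IHX. Qed.

Lemma order_children T : order T = (orders (children T)).+1.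
Proof. by elim: T => //= X -> Y _; rewrite /orders /=; lia. Qed.

Lemma has_big_children T : has_big T = has (fun X => 4 <= order X) (children T).
Proof. by elim: T => //= X -> Y _; rewrite orbC. Qed.

Lemma order_gt0 T : 0 < order T.
Proof. by elim: T => //= X IHX Y _; rewrite addn_gt0 IHX. Qed.

Lemma order_le3 T : order T <= 3 ->
  T = Root \/ T = P2 \/ T = P3e \/ T = P3c.
Proof.
have gt0 := order_gt0.
case: T => [|[|X1 X2] [|Y1 Y2]] /=; auto.
- case: Y1 => [|Z1 Z2]; case: Y2 => [|W1 W2] /=; auto.
  + have := gt0 W1; have := gt0 W2; lia.
  + have := gt0 Z1; have := gt0 Z2; lia.
  + have := gt0 Z1; have := gt0 Z2; have := gt0 W1; lia.
- case: X1 => [|Z1 Z2]; case: X2 => [|W1 W2] /=; auto.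
  + have := gt0 W1; have := gt0 W2; lia.
  + have := gt0 Z1; have := gt0 Z2; lia.
  + have := gt0 Z1; have := gt0 Z2; have := gt0 W1; lia.
- have := gt0 X1; have := gt0 X2; have := gt0 Y1; have := gt0 Y2; lia.
Qed.

Definition is_end3 T := if T is P3e then true else false.
Definition of_order m T := order T == m.

(* The profiles of a root, and of a vertex of a cycle of length 3 * t + 2, with
   i single vertices, j paths P2 and some trees of order 3 hung at it, p of the
   latter being P3e; w is 3 to the number of trees of order 3. *)
Definition small_profile i j p w :=
  match i, j with
  | 0, 0 => Profile Alone w 1 p
  | 1, 0 => Profile Paired w 1 1
  | 0, 1 => Profile Level w 1 p.+1
  | 2, 0 => Profile Level w 0 2
  | 1, 1 => Profile Level w 0 1
  | _, _ => Profile Level w 0 0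
  end.

Definition small_potted t i j p w :=
  match i, j with
  | 0, 0 => Profile Level (t.+1 * w) 1 (2 * t + p)
  | 1, 0 => Profile Level (t.+1 * w) 0 1
  | _, _ => Profile Level (t.+1 * w) 0 0
  end.

Definition small L := all (fun X => order X <= 3) L.

Lemma prof_le3 T : order T <= 3 ->
  [/\ order T = 1, is_end3 T = false & prof T = Profile Alone 1 1 0] \/
  [/\ order T = 2, is_end3 T = false & prof T = Profile Paired 1 1 1] \/
  [/\ order T = 3, is_end3 T = true & prof T = Profile Level 1 1 1] \/
  [/\ order T = 3, is_end3 T = false & prof T = Profile Level 1 0 2].
Proof. by case/order_le3=> [|[|[|]]] ->; [left|right; left|do 2!right; left|do 3!right]. Qed.

Lemma pjoins_small L : small L ->
  pjoins (Profile Alone 1 1 0) L =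
  small_profile (count (of_order 1) L) (count (of_order 2) L) (count is_end3 L)
    (3 ^ count (of_order 3) L).
Proof.
elim: L => [|T L IH] // /andP[/prof_le3 T_small /IH]; rewrite {IH}/= => ->.
rewrite /of_order -!/(of_order _).
move: (count (of_order 1) L) (count (of_order 2) L) (count is_end3 L) (count (of_order 3) L) =>
  i j p w.
case: T_small => [|[|[|]]] [-> -> ->]; rewrite /= ?add0n ?add1n ?expnS; move: (3 ^ w) => W;
case: i => [|[|[|i]]]; case: j => [|[|j]]; rewrite /pjoin /ptotal /=; congr Profile; lia.
Qed.

Lemma pjoins_potted_small t L : small L ->
  pjoins (Profile Level t.+1 1 (2 * t)) L =
  small_potted t (count (of_order 1) L) (count (of_order 2) L) (count is_end3 L)
    (3 ^ count (of_order 3) L).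
Proof.
elim: L => [|T L IH]; first by rewrite /= muln1 addn0.
case/andP=> /prof_le3 T_small /IH; rewrite {IH}/= => ->.
rewrite /of_order -!/(of_order _).
move: (count (of_order 1) L) (count (of_order 2) L) (count is_end3 L) (count (of_order 3) L) =>
  i j p w.
case: T_small => [|[|[|]]] [-> -> ->]; rewrite /= ?add0n ?add1n ?expnS; move: (3 ^ w) => W;
case: i => [|[|[|i]]]; case: j => [|[|j]]; rewrite /pjoin /ptotal /=; congr Profile; nia.
Qed.

Lemma orders_small L : small L ->
  orders L = count (of_order 1) L + 2 * count (of_order 2) L + 3 * count (of_order 3) L.
Proof.
rewrite /orders; elim: L => //= T L IH /andP[/order_le3 T_small /IH->].
by case: T_small => [|[|[|]]] ->; rewrite /of_order /=; lia.
Qed.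

Lemma count_end3_le L : count is_end3 L <= count (of_order 3) L.
Proof. by apply: sub_count => T; rewrite /of_order; case: T => // -[] // -[] // [] // []. Qed.

(* By [realizes_cycle], the base is the profile of a vertex of the cycle of
   length 3 * t + 2. *)
Definition potted_profile t L := pjoins (Profile Level t.+1 1 (2 * t)) L.

Definition large T := 4 <= order T.

Lemma smallPn L : ~~ small L -> has large L.
Proof. by rewrite /small -has_predC; apply: sub_has => T /=; rewrite /large ltnNge. Qed.

Lemma prof_big_bounds T : has_big T -> profile_big_bounds (order T) (3 ^ height T) (prof T).
Proof.
elim: T => //= X IHX Y _ hb; rewrite !expnD.
apply: pjoin_big (pow_caseP _) (pow_caseP _) (prof_bounds X) (prof_bounds Y) _.
by case/orP: hb => [/IHX|]; [right|left].
Qed.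

Lemma prof_big_weight T a b c : has_big T -> prof T = Profile Level a b c ->
  let U := 3 * a + b + c in let V := 2 * a + 2 * b + c in
  U <= 3 ^ height T /\ U + V < 2 * 3 ^ height T \/ [/\ order T = 6, U <= 10 & V <= 8].
Proof.
case: T => //= X Y hb E; rewrite !expnD.
have := @pjoin_big_weight _ _ _ _ _ _ _ _ (pow_caseP _) (pow_caseP _) (prof_bounds X)
  (prof_bounds Y).
rewrite E; apply=> //.
by case/orP: hb => [/prof_big_bounds|]; [right|left].
Qed.

(* M, Z and Y count the maximum dissociation sets of the forest L that are
   arbitrary, that avoid all roots, and that contain exactly one root, isolated. *)
Lemma potted_profile_bounds t L : let P := 3 ^ sumn (map height L) in
  exists M Z Y, potted_profile t L = Profile Level (t.+1 * M) Z (2 * t * Z + Y) /\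
  (M <= P /\ (has large L -> 3 * M <= 2 * P)) /\
  (L = [::] /\ [/\ M = 1, Z = 1, Y = 0 & P = 1] \/
   (size L = 1 /\ pkind (prof (head Root L)) = Level) /\ 3 * Z <= P /\ 3 * Y <= P \/
   9 * Z <= P /\ 9 * Y <= 2 * P \/
   Z = 0 /\ Y <= P /\ (has large L -> 3 * Y <= P)).
Proof.
elim: L => [|T L [M [Z [Y [E [[leM hM] IH]]]]]] /=.
  by exists 1, 1, 0; rewrite muln1 addn0; split; [rewrite muln1|split=> //; left].
have := prof_bounds T; rewrite -/(potted_profile t L)
  E expnD [3 ^ _ * _]mulnC -[large T]/(4 <= order T).
move: IH hM leM.
have PgtO : 0 < 3 ^ sumn (map height L) by rewrite expn_gt0.
have := PgtO; move: (height T) (order T) (3 ^ sumn (map height L)) (3 ^ height T) => e n P Q P0.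
case: (prof T) => k a b c IH hM leM.
have {leM hM} HM m : m <= Q -> (4 <= n -> 3 * m <= 2 * Q) ->
    M * m <= P * Q /\ ((4 <= n) || has large L -> 3 * (M * m) <= 2 * (P * Q)).
  move=> le_m lm; split=> [|/orP[/lm le_m'|/hM le_M']]; first exact: leq_mul.
    by have := leq_mul leM le_m'; lia.
  by have := leq_mul le_M' le_m; lia.
case: k => /= -[_ HT].
(* In a [Level] tree all three sorts have full size, so its root can be the isolated one (Z * b) or
   be avoided (Y * a). Each such tree costs Z a factor 1/3; from two of them on this gives the
   bounds with 9. *)
- exists (M * (a + b + c)), (Z * a), (Y * a + Z * b); split; last split.
  + by rewrite /pjoin /ptotal /=; congr Profile; nia.
  + by apply: HM; split_hyps; lia.
  + have [ha hb] : 3 * a <= Q /\ 3 * b <= Q by split_hyps; lia.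
    case: IH => [[L0 [M1 Z1 Y0 P1]]|[[_ [hZ hY]]|[[hZ hY]|[Z0 [hY _]]]]].
    * by right; left; rewrite L0 /=; subst; split=> //; lia.
    * right; right; left; have := leq_mul hZ ha; have := leq_mul hZ hb; have := leq_mul hY ha; lia.
    * right; right; left; have := leq_mul hZ ha; have := leq_mul hZ hb; have := leq_mul hY ha; lia.
    * right; right; right; have := leq_mul hY ha; subst; lia.
(* In a [Paired] tree only the sets that match the root reach the maximum; avoiding or isolating the
   root loses a vertex, so both other counts vanish. *)
- exists (M * c), 0, 0; split; last split.
  + by rewrite /pjoin /ptotal /=; congr Profile; nia.
  + by apply: HM; split_hyps; lia.
  + by right; right; right; split=> //; split.
(* The root of an [Alone] tree belongs to every maximum set. So no such set avoids all roots, and if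
   exactly one root is used, it is this one. *)
- exists (M * (b + c)), 0, (Z * b); split; last split.
  + by rewrite /pjoin /ptotal /=; congr Profile; nia.
  + by apply: HM; split_hyps; lia.
  + right; right; right; split=> //.
    have [hb hb'] : b <= Q /\ (4 <= n -> 3 * b <= Q) by split_hyps; lia.
    have hZ : Z <= P by split_hyps; lia.
    split; first exact: leq_mul.
    case/orP=> [/hb' {}hb'|]; first by have := leq_mul hZ hb'; lia.
    case: IH => [[-> _] //|[[_ [hZ' _]]|[[hZ' hY]|[Z0 _]]]] _.
    * by have := leq_mul hZ' hb; lia.
    * by have := leq_mul hZ' hb; lia.
    * by rewrite Z0.
Qed.

Lemma height_kind T : 3 * height T + (if pkind (prof T) is Level then 0 else 1) <= order T.
Proof. by have := prof_bounds T; case: (prof T) => -[] a b c /= [? _]; lia. Qed.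

Lemma heights_orders L : 3 * sumn (map height L) <= orders L.
Proof.
by rewrite /orders; elim: L => //= T L IH; have := height_kind T; case: (pkind _); lia.
Qed.

(** A single tree of kind [Level] is excluded because there Z and Y are bounded only by P/3, and the
    three terms add up to (4/3)(t + 1) P. *)
Lemma potted_profile_large t L : 0 < t -> has large L ->
  (forall T, L = [:: T] -> pkind (prof T) <> Level) ->
  ptotal (potted_profile t L) < t.+1 * 3 ^ (orders L %/ 3).
Proof.
move=> t0 hL nsing.
have leP : 3 ^ sumn (map height L) <= 3 ^ (orders L %/ 3).
  by rewrite leq_exp2l // leq_divRL // mulnC heights_orders.
have P0 : 0 < 3 ^ sumn (map height L) by rewrite expn_gt0.
apply: leq_trans (leq_mul (leqnn _) leP).
have [M [Z [Y [-> [[_ /(_ hL) hM]]]]]] := potted_profile_bounds t L.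
rewrite /ptotal /=; move: (3 ^ _) P0 hM => P P0 hM; have tP : 0 < t * P by rewrite muln_gt0 t0.
case=> [[L0]|[[[sz1 kE] _]|[[hZ hY]|[Z0 [_ /(_ hL) hY]]]]].
- by rewrite L0 in hL.
- by case: L sz1 kE nsing {hL leP} => [|T [|]] //= _ kE /(_ T erefl).
(* The terms add up to (2/3)(t + 1) + (2t + 1)/9 + 2/9 = (8t + 9)/9, in units of P, which is below t
   + 1 for t > 0. In the next case they add up to (2/3)(t + 1) + 1/3, again below t + 1. *)
- by have := leq_mul (leqnn t) hZ; have := leq_mul (leqnn t) hM; lia.
- by have := leq_mul (leqnn t) hM; lia.
Qed.

Lemma potted_profile1 t T a b c : prof T = Profile Level a b c ->
  ptotal (potted_profile t [:: T]) = t * (3 * a + b + c) + (2 * a + 2 * b + c).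
Proof. by rewrite /potted_profile /= => ->; rewrite /pjoin /ptotal /= mulSn !mulnDr; lia. Qed.

(** * Closed forms of the bounds *)

Section Values.
Variables t s : nat.
Let k := 3 * t + 2.

Lemma x1E : x1 (3 * s.+1 + 1 + k) k = k * 3 ^ s + t.+1.
Proof.
have -> : 3 * s.+1 + 1 + k = 3 * s.+1 + k + 1 by lia.
rewrite /x1 addnAC addnK addnK mulKn // subn1 /=; congr (_ + _).
by rewrite /k -addnA (_ : 3 * t + 3 = t.+1 * 3) ?mulnK //; lia.
Qed.

Lemma x2E : x2 (3 * s.+1 + 1 + k) k = t.+1 * 3 ^ s.+1 + 1.
Proof.
have -> : 3 * s.+1 + 1 + k = 3 * s.+1 + k + 1 by lia.
by rewrite /x2 addnAC addnK addnK mulKn // subn1 /= /k expnS mulnA; congr (_ * _ + _); lia.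
Qed.

Lemma x3E : x3 (3 * s.+1 + k) k = k * 3 ^ s + t.+1 * s.+2 + 1.
Proof.
rewrite /x3 addnK mulKn // subn1 /= (_ : (k + 1) %/ 3 = t.+1) ?[s.+1 + 1]addn1 //.
by rewrite /k -addnA (_ : 3 * t + 3 = t.+1 * 3) ?mulnK //; lia.
Qed.

Lemma x4E : x4 (3 * s.+1 + k) k = t.+1 * 3 ^ s.+1 + s.+1 + (2 * t + 1).
Proof.
rewrite /x4 addnK mulKn // [s.+1 - 1]subn1 /= [3 ^ s.+1]expnS (_ : k + 1 = t.+1 * 3) /k;
  last by lia.
by rewrite -mulnA; move: (t.+1 * _) => T; lia.
Qed.

Lemma bound0E : dissociation_bound (3 * s.+1 + k) k =
  maxn (x3 (3 * s.+1 + k) k) (x4 (3 * s.+1 + k) k).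
Proof. by rewrite /dissociation_bound (_ : _ %% 3 = 2) // /k; lia. Qed.

Lemma bound1E : dissociation_bound (3 * s.+1 + 1 + k) k =
  maxn (x1 (3 * s.+1 + 1 + k) k) (x2 (3 * s.+1 + 1 + k) k).
Proof. by rewrite /dissociation_bound (_ : _ %% 3 = 0) // /k; lia. Qed.

Lemma bound2E : dissociation_bound (3 * s.+1 + 2 + k) k = t.+1 * 3 ^ s.+1.
Proof.
rewrite /dissociation_bound (_ : _ %% 3 = 1); last by rewrite /k; lia.
rewrite addnK addnK mulKn // subn1 /= expnS mulnA; congr (_ * _); rewrite /k; lia.
Qed.

End Values.

(** * Extremal forests *)

Definition threes L := all (of_order 3) L.

(* [extremal]i describes the forests hung at the cycle for the family G_i. *)
Definition extremal1 L := exists T s, L = [:: T] /\ Permutation (children T) (P2 :: nseq s P3e).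
Definition extremal2 L := exists T L',
  [/\ L = [:: T], threes L' & Permutation (children T) (Root :: P2 :: L')].
Definition extremal6 L := exists L', [/\ 0 < size L', threes L' & Permutation L (P2 :: L')].
Definition extremal7 L := exists L',
  [/\ 0 < size L', threes L' & Permutation L (Root :: Root :: L')].
Definition extremal8 L := exists2 s, 0 < s & Permutation L (nseq s P3e).
Definition extremal9 L := exists L', [/\ 0 < size L', threes L' & Permutation L (Root :: L')].

Lemma perm_cons_cat A (x : A) (s a b : seq A) :
  Permutation s (a ++ b) -> Permutation (x :: s) (a ++ x :: b).
Proof. exact: Permutation_cons_app. Qed.

Lemma small_perm L : small L -> let p := count is_end3 L in
  Permutation L (nseq (count (of_order 1) L) Root ++ nseq (count (of_order 2) L) P2 ++
                 nseq p P3e ++ nseq (count (of_order 3) L - p) P3c).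
Proof.
elim: L => [|T L IH] //= /andP[T_small /IH].
have := count_end3_le L.
move: (count _ L) (count _ L) (count _ L) (count _ L) => i p j w /= le_pw {}IH.
case/order_le3: T_small => [|[|[|]]] ->; rewrite ?add0n ?add1n /=.
- exact: perm_skip.
- exact: perm_cons_cat.
- by rewrite subSS catA; apply: perm_cons_cat; rewrite -catA.
- by rewrite subSn //= !catA; apply: perm_cons_cat; rewrite -!catA.
Qed.

Lemma threes_nseq p q : threes (nseq p P3e ++ nseq q P3c).
Proof. by rewrite /threes all_cat !all_nseq /= !orbT. Qed.

(** A common target for all strict comparisons, obtained from [x4], [x2] and the middle bound. The
    extra term for residue 0 comes from [x4]; it is what beats the exceptional trees of order 6 and
    the forests containing [P3c]. *)
Lemma bound_ge t N : 3 <= N ->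
  t.+1 * 3 ^ (N %/ 3) + (if N %% 3 == 0 then N %/ 3 + (2 * t + 1) else 0) <=
    dissociation_bound (N + (3 * t + 2)) (3 * t + 2).
Proof.
move=> N3; have [s ->] : exists s, N = 3 * s.+1 + N %% 3 by exists (N %/ 3).-1; lia.
have lt_r : N %% 3 < 3 by rewrite ltn_mod.
rewrite (mulnC 3) divnMDl // modnMDl modn_mod -(mulnC 3) (divn_small lt_r) addn0 {N3}.
case: (N %% 3) lt_r => [|[|[|//]]] _ /=.
- by rewrite !addn0 bound0E x4E addnA leq_maxr.
- by rewrite bound1E x2E addn0 leq_max leq_addr orbT.
- by rewrite bound2E addn0.
Qed.

(** The second inequality is the case t = 1; each further unit of t adds U on the left and P on the
    right. *)
Lemma weight_lt t U V P : 0 < t -> U <= P -> U + V < 2 * P -> t * U + V < t.+1 * P.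
Proof. by case: t => // t _ hU hUV; have := leq_mul (leqnn t) hU; lia. Qed.

Lemma potted_profile_extremal t L : 0 < t -> 3 <= orders L ->
  let N := orders L in let k := 3 * t + 2 in let n := N + k in
  let m := ptotal (potted_profile t L) in
  m < dissociation_bound n k \/
  [\/ N %% 3 = 0 /\ (extremal8 L /\ m = x4 n k \/ extremal1 L /\ m = x3 n k),
      N %% 3 = 1 /\ (extremal9 L /\ m = x2 n k \/ extremal2 L /\ m = x1 n k)
    | N %% 3 = 2 /\ (extremal6 L \/ extremal7 L) /\ m = dissociation_bound n k].
Proof.
move=> t0 N3 N k n m.
have bnd := bound_ge t N3; rewrite -/N -/k -/n in bnd.
have pow_gt w : w.+1 <= N %/ 3 -> 3 * 3 ^ w <= 3 ^ (N %/ 3) by move=> le_w;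
  rewrite -expnS leq_exp2l.
have [Ls|/smallPn Ll] := boolP (small L).
  have perm := small_perm Ls; have NE := orders_small Ls; have := count_end3_le L.
  rewrite {}/m /potted_profile (pjoins_potted_small _ Ls); move: perm NE; rewrite -/N.
  move: (count (of_order 1) L) (count (of_order 2) L) (count is_end3 L) (count (of_order 3) L).
  move=> i j p w perm NE le_pw.
  have w_gt0 : 0 < 3 ^ w by rewrite expn_gt0.
  (* For forests with i + 2j >= 3: the vertices outside the trees of order 3 would suffice for one
     more such tree, so a whole factor 3 is lost. *)
  have loser : w.+1 <= N %/ 3 -> t.+1 * 3 ^ w < dissociation_bound n k.
    move=> /pow_gt lt_w; apply: leq_trans bnd; rewrite /=.
    by apply: leq_trans (leq_addr _ _); rewrite ltn_pmul2l //; lia.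
  case: i j perm NE => [|[|[|i]]] [|[|j]] /= perm NE.
  - case: w le_pw perm NE pow_gt w_gt0 loser => [|w] le_pw perm NE _ _ _; first lia.
    have nE : n = 3 * w.+1 + k by rewrite /n; lia.
    (* A tree of order 3 can have its root isolated in a set of full size only if it is [P3e]. Each
       [P3e] thus adds one set, in which w is matched to its root, and the maximum requires all
       trees to be [P3e]. *)
    have [lt_pw|] := ltnP p w.+1.
      left; apply: leq_trans bnd; have -> : N %% 3 = 0 by lia.
      have -> : N %/ 3 = w.+1 by lia.
      by rewrite /ptotal /=; lia.
    move=> ge_pw; have pE : p = w.+1 by lia.
    right; constructor 1; split; [lia|left; split].
      by exists w.+1 => //; rewrite pE subnn cats0 in perm.
    by rewrite nE x4E /ptotal /= pE; lia.
  - right; constructor 3; split; first lia.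
    case: w le_pw perm NE pow_gt w_gt0 loser => [|w] le_pw perm NE _ _ _; first lia.
    split; [left|].
      by eexists; split; last exact: perm; rewrite ?threes_nseq // size_cat !size_nseq; lia.
    by rewrite /n (_ : N = 3 * w.+1 + 2) ?bound2E /ptotal /=; lia.
  - left; rewrite /ptotal /= !addn0; apply: loser; lia.
  - right; constructor 2; split; first lia.
    case: w le_pw perm NE pow_gt w_gt0 loser => [|w] le_pw perm NE _ _ _; first lia.
    left; split.
      by eexists; split; last exact: perm; rewrite ?threes_nseq // size_cat !size_nseq; lia.
    by rewrite /n (_ : N = 3 * w.+1 + 1) ?x2E /ptotal /=; lia.
  - left; rewrite /ptotal /= !addn0; apply: loser; lia.
  - left; rewrite /ptotal /= !addn0; apply: loser; lia.
  - right; constructor 3; split; first lia.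
    case: w le_pw perm NE pow_gt w_gt0 loser => [|w] le_pw perm NE _ _ _; first lia.
    split; [right|].
      by eexists; split; last exact: perm; rewrite ?threes_nseq // size_cat !size_nseq; lia.
    by rewrite /n (_ : N = 3 * w.+1 + 2) ?bound2E /ptotal /=; lia.
  - left; rewrite /ptotal /= !addn0; apply: loser; lia.
  - left; rewrite /ptotal /= !addn0; apply: loser; lia.
  - left; rewrite /ptotal /= !addn0; apply: loser; lia.
  - left; rewrite /ptotal /= !addn0; apply: loser; lia.
  - left; rewrite /ptotal /= !addn0; apply: loser; lia.
have gen : (forall T, L = [:: T] -> pkind (prof T) <> Level) -> m < dissociation_bound n k.
  move=> ns; apply: leq_trans bnd; apply: leq_trans (leq_addr _ _).
  exact: potted_profile_large.
case: L @N @n @m N3 bnd pow_gt Ll gen => [|T [|T' L]] //; last first.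
  by move=> N n m N3 bnd pow_gt Ll gen; left; apply: gen.
move=> N n m N3 bnd pow_gt; rewrite /= orbF /large => T4 gen.
case E: (prof T) => [kd a b c].
have [kE|kN] : kd = Level \/ kd <> Level by case: kd {E}; [left|right|right].
  rewrite {kd}kE in E; rewrite {gen}.
  have NE : N = order T by rewrite /N /orders /= addn0.
  rewrite {}/m (potted_profile1 _ E).
  have [hb|] := boolP (has_big T).
    left; case: (prof_big_weight hb E) => [[hU hUV]|[T6 hU hV]].
      apply: leq_trans bnd; apply: leq_trans (leq_addr _ _).
      have leP : 3 ^ height T <= 3 ^ (N %/ 3).
        by rewrite leq_exp2l // leq_divRL // mulnC NE; have := height_kind T; rewrite E; lia.
      exact: leq_trans (weight_lt t0 hU hUV) (leq_mul (leqnn _) leP).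
    (* Here P = 9 and the available bound is 9(t + 1) + 2 + (2t + 1) = 11t + 12, against 10t + 8. *)
    apply: leq_trans bnd; rewrite NE T6 (_ : 6 %/ 3 = 2) // (_ : 6 %% 3 == 0) // (_ : 3 ^ 2 = 9) //.
    by have := leq_mul (leqnn t) hU; lia.
  rewrite has_big_children => nbig.
  have Ts : small (children T) by apply: contraNT nbig => /smallPn.
  have perm := small_perm Ts; have := orders_small Ts; have := count_end3_le (children T).
  move: E; rewrite prof_children (pjoins_small Ts).
  have : N = (orders (children T)).+1 by rewrite NE order_children.
  move: (orders _) => N' NE'; move: perm.
  move: (count (of_order 1) _) (count (of_order 2) _) (count is_end3 _) (count (of_order 3) _).
  move=> i j p w perm E le_pw N'E.
  have w_gt0 : 0 < 3 ^ w by rewrite expn_gt0.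
  (* With b = c = 0 the number is (3t + 2) 3^w, below (t + 1) 3^(w + 1). *)
  have loser : a = 3 ^ w -> b = 0 -> c = 0 -> w.+1 <= N %/ 3 ->
      t * (3 * a + b + c) + (2 * a + 2 * b + c) < dissociation_bound n k.
    move=> -> -> -> /pow_gt lt_w; apply: leq_trans bnd; rewrite -/N.
    by apply: leq_trans (leq_addr _ _); have := leq_mul (leqnn t.+1) lt_w; lia.
  (* The pairs (0, 0) and (1, 0) are of kinds [Alone] and [Paired] and disappear. The pair (0, 1)
     leads to [x3], (1, 1) to [x1]; (2, 0) has the leading term of [x3] but a smaller remainder. *)
  case: i j perm E N'E => [|[|[|i]]] [|[|j]] //= perm [aE bE cE] N'E.
  - have nE : n = 3 * w.+1 + k by rewrite /n -/N; lia.
    have [lt_pw|ge_pw] := ltnP p w.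
      left; apply: (@leq_trans (x3 n k)); last by rewrite nE bound0E leq_maxl.
      by rewrite nE x3E -aE -bE -cE; nia.
    have pE : p = w by lia.
    right; constructor 1; split; [lia|right; split].
      by exists T, w; rewrite pE subnn cats0 in perm.
    by rewrite nE x3E -aE -bE -cE pE; nia.
  - by left; apply: loser; lia.
  - right; constructor 2; split; first lia.
    right; split; last by rewrite (_ : n = 3 * w.+1 + 1 + k) ?x1E -?aE -?bE -?cE; nia.
    by exists T; eexists; split; last exact: perm; rewrite ?threes_nseq.
  - by left; apply: loser; lia.
  - left; have nE : n = 3 * w.+1 + k by rewrite /n -/N; lia.
    apply: (@leq_trans (x3 n k)); last by rewrite nE bound0E leq_maxl.
    by rewrite nE x3E -aE -bE -cE; nia.
  - by left; apply: loser; lia.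
  - by left; apply: loser; lia.
  - by left; apply: loser; lia.
  - by left; apply: loser; lia.
  - by left; apply: loser; lia.
by left; apply: gen => _ [<-]; rewrite E.
Qed.

(** * Values at the extremal forests *)

Lemma count_perm A (a : pred A) s s' : Permutation s s' -> count a s = count a s'.
Proof. by elim=> //= [x l l' _ -> | x y l | l l' l'' _ -> _ ->] //; rewrite addnCA. Qed.

Lemma all_perm A (a : pred A) s s' : Permutation s s' -> all a s = all a s'.
Proof. by elim=> //= [x l l' _ -> | x y l | l l' l'' _ -> _ ->] //; rewrite andbCA. Qed.

Lemma threesE L : threes L ->
  [/\ small L, count (of_order 1) L = 0, count (of_order 2) L = 0 & count (of_order 3) L = size L].
Proof.
elim: L => //= T L IH /andP[T3 /IH[-> -> -> ->]].
by rewrite /of_order in T3 *; rewrite (eqP T3).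
Qed.

Section Values.
Variables (t : nat) (L : seq rtree).
Let k := 3 * t + 2.
Let n := orders L + k.
Let m := ptotal (potted_profile t L).

Lemma small_values L' : Permutation L L' -> small L' ->
  m = ptotal (small_potted t (count (of_order 1) L') (count (of_order 2) L')
                (count is_end3 L') (3 ^ count (of_order 3) L')) /\
  orders L = count (of_order 1) L' + 2 * count (of_order 2) L' + 3 * count (of_order 3) L'.
Proof.
move=> LL' sm; have Ls : small L by rewrite /small (all_perm _ LL').
by rewrite /m /potted_profile pjoins_potted_small // orders_small // !(count_perm _ LL').
Qed.

Lemma extremal8_value : extremal8 L -> m = x4 n k.
Proof.
case=> [[//|s] _ LL'].
have [] := small_values LL'; first by rewrite /small all_nseq /= ?orbT.
rewrite !count_nseq /= !mul1n /n => -> ->.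
by rewrite x4E /ptotal /=; lia.
Qed.

Lemma extremal9_value : extremal9 L -> m = x2 n k.
Proof.
case=> L' [L0 /threesE[L's c1 c2 c3] LL'].
have [] := small_values LL'; first by rewrite /= L's.
rewrite /= c1 c2 c3 /n => -> ->; case: (size L') L0 => // s _.
by rewrite (_ : 1 + 0 + 2 * (0 + 0) + 3 * (0 + s.+1) = 3 * s.+1 + 1)
  ?x2E ?add0n /ptotal /= ?addn0 ?add0n; lia.
Qed.

Lemma extremal6_value : extremal6 L -> m = dissociation_bound n k.
Proof.
case=> L' [L0 /threesE[L's c1 c2 c3] LL'].
have [] := small_values LL'; first by rewrite /= L's.
rewrite /= c1 c2 c3 /n => -> ->; case: (size L') L0 => // s _.
by rewrite (_ : 0 + 0 + 2 * (1 + 0) + 3 * (0 + s.+1) = 3 * s.+1 + 2)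
  ?bound2E ?add0n /ptotal /= ?addn0 ?add0n; lia.
Qed.

Lemma extremal7_value : extremal7 L -> m = dissociation_bound n k.
Proof.
case=> L' [L0 /threesE[L's c1 c2 c3] LL'].
have [] := small_values LL'; first by rewrite /= L's.
rewrite /= c1 c2 c3 /n => -> ->; case: (size L') L0 => // s _.
by rewrite (_ : 1 + (1 + 0) + 2 * (0 + (0 + 0)) + 3 * (0 + (0 + s.+1)) = 3 * s.+1 + 2)
           ?bound2E ?add0n /ptotal /= ?addn0 ?add0n; lia.
Qed.

Lemma extremal1_value : extremal1 L -> m = x3 n k.
Proof.
case=> T [s [LT TP]]; rewrite /m /n LT /orders /= addn0 order_children.
have Ts : small (children T) by rewrite /small (all_perm _ TP) /= all_nseq /= ?orbT.
have := pjoins_small Ts; have := orders_small Ts.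
rewrite !(count_perm _ TP) /= !count_nseq /= !mul1n => ->;
  rewrite -prof_children => /potted_profile1->.
by rewrite (_ : (0 + 0 * s + 2 * (1 + 0 * s) + 3 * (0 + s)).+1 = 3 * s.+1) ?x3E ?add0n; lia.
Qed.

Lemma extremal2_value : extremal2 L -> m = x1 n k.
Proof.
case=> T [L' [LT /threesE[L's c1 c2 c3] TP]]; rewrite /m /n LT /orders /= addn0 order_children.
have Ts : small (children T) by rewrite /small (all_perm _ TP).
have := pjoins_small Ts; have := orders_small Ts.
rewrite !(count_perm _ TP) /= c1 c2 c3 => ->; rewrite -prof_children => /potted_profile1->.
by rewrite (_ : (1 + (0 + 0) + 2 * (0 + (1 + 0))
  + 3 * (0 + (0 + size L'))).+1 = 3 * (size L').+1 + 1)
           ?x1E ?add0n; lia.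
Qed.

End Values.

(** * Pointed graphs *)

Definition pisomorphic (p q : pgraph) : Prop :=
  exists f : p -> q, [/\ bijective f, forall x y, f x -- f y = x -- y & f (point p) = point q].

Lemma pisomorphic_refl p : pisomorphic p p.
Proof. by exists id; split=> //; exists id. Qed.

Lemma pisomorphic_sym p q : pisomorphic p q -> pisomorphic q p.
Proof.
case=> f [[g fK gK] fE fp]; exists g; split; first by exists f.
  by move=> x y; rewrite -fE !gK.
by rewrite -fp fK.
Qed.

Lemma pisomorphic_trans p q r : pisomorphic p q -> pisomorphic q r -> pisomorphic p r.
Proof.
case=> f [bf fE fp] [g [bg gE gp]]; exists (g \o f); split; first exact: bij_comp.
  by move=> x y /=; rewrite gE fE.
by rewrite /= fp gp.
Qed.

Lemma inj_surj_bij (A B : finType) (f : A -> B) :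
  injective f -> (forall y, exists x, f x = y) -> bijective f.
Proof.
move=> f_inj f_surj; have ex y : exists x, f x == y by have [x <-] := f_surj y; exists x.
exists (fun y => xchoose (ex y)) => [x|y]; last exact/eqP/(xchooseP (ex y)).
exact/f_inj/eqP/(xchooseP (ex (f x))).
Qed.

Definition plink (p q : pgraph) : pgraph :=
  @PGraph (link (point p) (point q)) (inl (point p)).

Definition pglue (p q : pgraph) : pgraph := glue (point p) (point q).

(** Isomorphisms out of a link are built from embeddings of its two halves whose images partition
    the target and are joined by one edge only. *)
Lemma plinkP (p q r : pgraph) (f : p -> r) (g : q -> r) :
  injective f -> injective g -> f (point p) = point r ->
  (forall x y, f x <> g y) ->
  (forall z, (exists x, f x = z) \/ (exists y, g y = z)) ->
  (forall x x', f x -- f x' = x -- x') -> (forall y y', g y -- g y' = y -- y') ->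
  (forall x y, f x -- g y = (x == point p) && (y == point q)) ->
  pisomorphic (plink p q) r.
Proof.
move=> f_inj g_inj fp fNg cover fE gE fgE.
exists (fun z => match z with inl x => f x | inr y => g y end); split=> //.
  apply: inj_surj_bij.
    by move=> [x|y] [x'|y'] //= => [/f_inj->|/fNg|/esym/fNg|/g_inj->].
  by move=> z; case: (cover z) => -[x <-]; [exists (inl x)|exists (inr x)].
by move=> [x|y] [x'|y'] //=; rewrite sedge_sym fgE.
Qed.

Lemma pglueP (p q r : pgraph) (f : p -> r) (g : q -> r) :
  injective f -> injective g -> f (point p) = point r -> g (point q) = point r ->
  (forall x y, f x = g y -> y = point q) ->
  (forall z, (exists x, f x = z) \/ (exists y, g y = z)) ->
  (forall x x', f x -- f x' = x -- x') -> (forall y y', g y -- g y' = y -- y') ->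
  (forall x y, x != point p -> y != point q -> ~~ (f x -- g y)) ->
  pisomorphic (pglue p q) r.
Proof.
move=> f_inj g_inj fp gp fg cover fE gE fgE.
have fgE' x (y : {y : q | y != point q}) : f x -- g (val y) = (x == point p) && (point q -- val y).
  have [-> /=|Nx] := eqVneq x (point p); first by rewrite fp -gp gE.
  exact/negbTE/fgE/(valP y).
exists (fun z => match z with inl x => f x | inr y => g (val y) end); split=> //.
  apply: inj_surj_bij.
    move=> [x|y] [x'|y'] //= => [/f_inj->|/fg y'E|/esym/fg yE|/g_inj/val_inj->] //.
      by case/negP: (valP y'); apply/eqP.
    by case/negP: (valP y); apply/eqP.
  move=> z; case: (cover z) => -[x <-]; first by exists (inl x).
  have [->|Nx] := eqVneq x (point q); first by exists (inl (point p)); rewrite fp gp.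
  by exists (inr (exist _ x Nx)).
move=> [x|y] [x'|y'] //=; first by rewrite fgE'.
by rewrite sedge_sym fgE'.
Qed.

(** The embedding of the second operand: [glue] drops its point from the carrier, so that vertex has
    to be sent to the point of [p]. *)
Definition gluer (p q : pgraph) (y : q) : pglue p q :=
  if insub y is Some y' then inr y' else inl (point p).

Lemma gluer_point (p q : pgraph) : gluer p (point q) = inl (point p).
Proof. by rewrite /gluer insubF ?eqxx. Qed.

Lemma gluer_neq (p q : pgraph) (y : q) (Ny : y != point q) : gluer p y = inr (exist _ y Ny).
Proof. by rewrite /gluer (insubT (fun y => y != point q) Ny). Qed.

Lemma gluer_inj (p q : pgraph) : injective (@gluer p q).
Proof.
move=> x y; have [->|Nx] := eqVneq x (point q); have [->|Ny] := eqVneq y (point q) => //.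
- by rewrite gluer_point gluer_neq.
- by rewrite gluer_point gluer_neq.
- by rewrite !gluer_neq => -[].
Qed.

Lemma gluer_edge (p q : pgraph) (x y : q) : gluer p x -- gluer p y = x -- y.
Proof.
have [->|Nx] := eqVneq x (point q); have [->|Ny] := eqVneq y (point q).
- by rewrite !sedge_irrefl.
- by rewrite gluer_point gluer_neq /= eqxx.
- by rewrite gluer_point gluer_neq /= eqxx /= sedge_sym.
- by rewrite !gluer_neq.
Qed.

Lemma gluer_inl (p q : pgraph) x (y : q) : inl x = gluer p y -> y = point q.
Proof. by have [//|Ny] := eqVneq y (point q); rewrite gluer_neq. Qed.

Lemma gluer_cover (p q : pgraph) (z : pglue p q) : (exists x, inl x = z) \/ (exists y,
  gluer p y = z).
Proof.
case: z => [x|[y Ny]]; first by left; exists x.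
by right; exists y; rewrite gluer_neq.
Qed.

Lemma gluer_inl_edge (p q : pgraph) (x : p) (y : q) : x != point p -> y != point q ->
  ~~ ((inl x : pglue p q) -- gluer p y).
Proof. by move=> Nx Ny; rewrite gluer_neq /= (negbTE Nx). Qed.

Definition K1 : pgraph := @PGraph (path_graph 1) ord0.

Lemma plink_congr p p' q q' :
  pisomorphic p p' -> pisomorphic q q' -> pisomorphic (plink p q) (plink p' q').
Proof.
case=> f [/[dup]/bij_inj f_inj [f' fK f'K] fE fp] [g [/[dup]/bij_inj g_inj [g' gK g'K] gE gp]].
apply: (@plinkP _ _ (plink p' q') (inl \o f) (inr \o g)) => //=.
- by move=> x x' [/f_inj].
- by move=> x x' [/g_inj].
- by rewrite fp.
- by move=> [z|z]; [left; exists (f' z)|right; exists (g' z)] => /=; rewrite (f'K, g'K).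
- by move=> x y; rewrite -fp -gp !bij_eq //; [exists g'|exists f'].
Qed.

Lemma pglue_congr p p' q q' :
  pisomorphic p p' -> pisomorphic q q' -> pisomorphic (pglue p q) (pglue p' q').
Proof.
case=> f [/[dup]/bij_inj f_inj [f' fK f'K] fE fp] [g [/[dup]/bij_inj g_inj [g' gK g'K] gE gp]].
apply: (@pglueP _ _ (pglue p' q') (inl \o f) (@gluer p' q' \o g)) => //=.
- by move=> x x' [/f_inj].
- exact: inj_comp (@gluer_inj _ _) g_inj.
- by rewrite fp.
- by rewrite gp gluer_point.
- by move=> x y /gluer_inl; rewrite -gp => /g_inj.
- move=> z; case: (gluer_cover z) => -[x <-].
    by left; exists (f' x); rewrite f'K.
  by right; exists (g' x); rewrite g'K.
- by move=> y y'; rewrite -gE; apply: gluer_edge.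
- by move=> x y Nx Ny; apply: gluer_inl_edge; [rewrite -fp|rewrite -gp]; rewrite inj_eq.
Qed.

(** [Gw] puts the new tree first, whereas [graft] hangs it on what is already there; [glue] itself
    treats its operands asymmetrically. *)
Lemma pglue_comm (p q : pgraph) : pisomorphic (pglue p q) (pglue q p).
Proof.
apply: (@pglueP _ _ (pglue q p) (@gluer q p) inl) => //.
- exact: gluer_inj.
- by move=> x y [].
- exact: gluer_point.
- by move=> x y E; have xp := gluer_inl (esym E); move: E; rewrite xp gluer_point => -[].
- by move=> z; case: (gluer_cover z) => -[x <-]; [right; exists x|left; exists x].
- exact: gluer_edge.
- by move=> x y Nx Ny; rewrite sedge_sym gluer_inl_edge.
Qed.

Lemma pglue_plink (p q : pgraph) a : pisomorphic (pglue p (plink q a)) (plink (pglue p q) a).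
Proof.
pose g (z : plink q a) : plink (pglue p q) a :=
  match z with inl y => inl (gluer p y) | inr y => inr y end.
apply: (@pglueP _ _ (plink (pglue p q) a) (fun x => inl (inl x)) g) => //=.
- by move=> x y [].
- by move=> [x|x] [y|y] //= [] // => [/gluer_inj->|->].
- by rewrite gluer_point.
- by move=> x [y|y] //= [/gluer_inl->].
- move=> [z|z]; last by right; exists (inr z).
  by case: (gluer_cover z) => -[x <-]; [left; exists x|right; exists (inl x)].
- move=> [x|x] [y|y] //=; first exact: gluer_edge.
    by rewrite -(gluer_point p q) (inj_eq (@gluer_inj _ _)).
  by rewrite -(gluer_point p q) (inj_eq (@gluer_inj _ _)).
- move=> x [y|y] Nx Ny; first by apply: gluer_inl_edge; rewrite // -(inj_eq (@inl_inj q a)).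
  by rewrite /= negb_and; apply/orP; left; apply: contraNneq Nx => -[->].
Qed.

Lemma pglue_K1 p : pisomorphic (pglue p K1) p.
Proof.
apply: (@pglueP _ _ p id (fun _ => point p)) => //.
- by move=> x y _; rewrite [x]ord1 [y]ord1.
- by move=> _ y _; rewrite [y]ord1.
- by move=> z; left; exists z.
- by move=> y y'; rewrite [y]ord1 [y']ord1 !sedge_irrefl.
- by move=> x y _; rewrite [y]ord1 eqxx.
Qed.

Lemma plink_swap p a b : pisomorphic (plink (plink p a) b) (plink (plink p b) a).
Proof.
pose f (z : plink p a) : plink (plink p b) a :=
  match z with inl x => inl (inl x) | inr y => inr y end.
apply: (@plinkP _ _ (plink (plink p b) a) f (fun z => inl (inr z))) => //.
- by move=> [x|x] [y|y] //= [] // ->.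
- by move=> x y [].
- by move=> [x|x] y.
- move=> [[x|x]|x]; [left|right|left]; by [exists (inl x)|exists x|exists (inr x)].
- by move=> [x|x] [y|y].
- by move=> [x|x] y /=.
Qed.

(** * Rooted trees as pointed graphs, and the trees G_w *)

Fixpoint interp T : pgraph := if T is Join X Y then plink (interp X) (interp Y) else K1.

Definition graft p L : pgraph := foldr (fun T q => plink q (interp T)) p L.

Lemma interp_children T : interp T = graft K1 (children T).
Proof. by elim: T => //= X -> Y _. Qed.

Lemma graft_perm p L L' : Permutation L L' -> pisomorphic (graft p L) (graft p L').
Proof.
elim=> /= [|T {}L {}L' _ IH|T T' {}L|L1 L2 L3 _ IH1 _ IH2].
- exact: pisomorphic_refl.
- exact: plink_congr (pisomorphic_refl _).
- exact: plink_swap.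
- exact: pisomorphic_trans IH2.
Qed.

Lemma pglue_graft p L : pisomorphic (pglue p (graft K1 L)) (graft p L).
Proof.
elim: L => [|T L IH] /=; first exact: pglue_K1.
apply: pisomorphic_trans (pglue_plink _ _ _) _.
exact: plink_congr (pisomorphic_refl _).
Qed.

Lemma path_leaf j (x : path_graph j.+2) : leaf x = (x == ord0) || (x == ord_max).
Proof.
apply/idP/orP => [/cards1P[y yE]|].
  have [x0|Nx0] := boolP (x == ord0); first by left.
  right; apply: contraT => Nxm; rewrite -!val_eqE /= in Nx0 Nxm.
  have lt_x := ltn_ord x.
  have lt1 : x.-1 < j.+2 by lia.
  have lt2 : x.+1 < j.+2 by lia.
  have : Ordinal lt1 \in [set y] by rewrite -yE inE /= /path_rel /=; lia.
  have : Ordinal lt2 \in [set y] by rewrite -yE inE /= /path_rel /=; lia.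
  by rewrite !inE => /eqP<- /eqP[]; lia.
have leafP y : (forall z : path_graph j.+2, x -- z = (z == y)) -> leaf x.
  by move=> E; rewrite /leaf /degree; apply/cards1P; exists y; apply/setP=> z; rewrite !inE E.
have lt1 : 1 < j.+2 by [].
have ltj : j < j.+2 by lia.
case=> /eqP xE.
  by apply: (leafP (Ordinal lt1)) => z; rewrite xE /= /path_rel /= -val_eqE /=; lia.
by apply: (leafP (Ordinal ltj)) => z; have := ltn_ord z; rewrite xE /= /path_rel /= -val_eqE /=;
  lia.
Qed.

Definition path_end j : pgraph := @PGraph (path_graph j.+1) ord0.

Lemma path_leaf_iso j (x : path_graph j.+2) :
  leaf x -> pisomorphic (PGraph x) (plink K1 (path_end j)).
Proof.
rewrite path_leaf => /orP x_end; apply: pisomorphic_sym.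
have [g [g_inj Ng g_edge gx cover]] : exists g : path_end j -> path_graph j.+2,
  [/\ injective g, forall y, g y <> x, forall y y', g y -- g y' = y -- y',
      forall y, x -- g y = (y == ord0)
    & forall z, z = x \/ exists y, g y = z].
  have ord_j (z : 'I_j.+1) : z < j.+2 by have := ltn_ord z; lia.
  case: x_end => /eqP ->.
    exists (lift ord0); split; first exact: lift_inj.
    - by move=> y /(congr1 val) /=.
    - by move=> y y'; rewrite /= /path_rel !lift0 !eqSS.
    - by move=> y; rewrite /= /path_rel !lift0 -val_eqE /=; lia.
    - by move=> z; case: (unliftP ord0 z) => [y ->|->]; [right; exists y|left].
  (* At the last vertex the remaining path is numbered backwards, so that the neighbour of the leaf
     becomes its point 0. *)
  exists (fun y => Ordinal (ord_j (rev_ord y))); split.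
  - by move=> y y' /(congr1 val) /= E; apply: ord_inj; have := ltn_ord y; have := ltn_ord y'; lia.
  - by move=> y /(congr1 val) /=; lia.
  - by move=> y y'; rewrite /= /path_rel /=; have := ltn_ord y; have := ltn_ord y'; lia.
  - by move=> y; rewrite /= /path_rel /= -val_eqE /=; have := ltn_ord y; lia.
  - move=> z; have [zm|Nz] := eqVneq z ord_max; [by left|right].
    have lt_z : j - z < j.+1 by lia.
    exists (Ordinal lt_z); apply: ord_inj => /=; move: Nz; rewrite -val_eqE /=.
    by have := ltn_ord z; lia.
apply: (@plinkP _ _ (PGraph x) (fun _ => x) g) => //=.
- by move=> y y' _; rewrite [y]ord1 [y']ord1.
- by move=> _ y E; apply: (Ng y).
- by move=> z; case: (cover z) => [->|]; [left; exists ord0|right].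
- by move=> y y'; rewrite [y]ord1 [y']ord1 /path_rel /=; lia.
- by move=> y y'; rewrite [y]ord1; apply: gx.
Qed.

Lemma path_end_link j : pisomorphic (path_end j.+1) (plink K1 (path_end j)).
Proof. by apply: path_leaf_iso; rewrite path_leaf eqxx. Qed.

Lemma path_end_interp j :
  pisomorphic (path_end j) (interp (iter j (Join Root) Root)).
Proof.
elim: j => [|j IH] /=; first exact: pisomorphic_refl.
apply: pisomorphic_trans (path_end_link j) _.
exact: plink_congr (pisomorphic_refl _) IH.
Qed.

Lemma claw_leaf (x : complete_bipartite 1 3) : leaf x -> exists i, x = inr i.
Proof.
case: x => [x|i _]; last by exists i.
case/cards1P=> y yE.
have inY (i : 'I_3) : inr i \in [set y] by rewrite -yE inE.
by have := inY ord0; have := inY ord_max; rewrite !inE => /eqP<-.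
Qed.

Lemma claw_leaf_iso (x : complete_bipartite 1 3) :
  leaf x -> pisomorphic (PGraph x) (plink K1 (interp P3c)).
Proof.
case/claw_leaf=> i ->; apply: pisomorphic_sym.
pose g (z : interp P3c) : complete_bipartite 1 3 :=
  match z with
  | inl (inl _) => inl ord0
  | inl (inr _) => inr (lift i ord0)
  | inr _ => inr (lift i ord_max)
  end.
apply: (@plinkP _ _ (PGraph (inr i : complete_bipartite 1 3)) (fun _ => inr i) g) => //=.
- by move=> y y' _; rewrite [y]ord1 [y']ord1.
- move=> [[y|y]|y] [[y'|y']|y'] /=; rewrite ?[y]ord1 ?[y']ord1 //;
  by move/(congr1 (fun z : complete_bipartite 1 3 => if z is inr h then val h else 0));
    rewrite /= /bump; lia.
- move=> _ [[y|y]|y] //;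
  by move/(congr1 (fun z : complete_bipartite 1 3 => if z is inr h then val h else 0));
    rewrite /= /bump; lia.
- move=> [z|z]; first by right; exists (inl (inl ord0)); rewrite [z]ord1.
  case: (unliftP i z) => [[[|[|//]] lt_y] ->|->]; last by left; exists ord0.
    by right; exists (inl (inr ord0)); congr (inr (lift _ _)); apply: ord_inj.
  by right; exists (inr ord0); congr (inr (lift _ _)); apply: ord_inj.
- by move=> y y'; rewrite [y]ord1 [y']ord1.
- by move=> [[y|y]|y] [[y'|y']|y'] //=; rewrite ?[y]ord1 ?[y']ord1.
- by move=> y [[y'|y']|y'] //=; rewrite [y]ord1 ?[y']ord1.
Qed.

(* Identifying any leaf of T with w amounts to hanging the tree t at w. *)
Definition hangs (T : sgraph) (t : rtree) : Prop :=
  (exists x : T, leaf x) /\ forall x : T, leaf x -> pisomorphic (PGraph x) (plink K1 (interp t)).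

Lemma hangs_path j : hangs (path_graph j.+2) (iter j (Join Root) Root).
Proof.
split=> [|x lx]; first by exists ord0; rewrite path_leaf eqxx.
apply: pisomorphic_trans (path_leaf_iso lx) _.
exact: plink_congr (pisomorphic_refl _) (path_end_interp j).
Qed.

Lemma hangs_claw : hangs (complete_bipartite 1 3) P3c.
Proof.
split; last exact: claw_leaf_iso.
exists (inr ord0); apply/cards1P; exists (inl ord0); apply/setP=> -[z|z]; rewrite !inE //.
by rewrite [z]ord1 eqxx.
Qed.

Lemma Gw_graft Ts L p : List.Forall2 hangs Ts L -> Gw Ts p -> pisomorphic p (graft K1 L).
Proof.
move=> TsL; elim: TsL p => [|T t {}Ts {}L [_ hangsT] _ IH] p pGw.
  by inversion pGw; apply: pisomorphic_refl.
inversion pGw as [|T' x Ts' p' lx p'Gw [TE TsE] pE].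
apply: pisomorphic_trans (pglue_comm (PGraph x) p') _.
apply: pisomorphic_trans (pglue_congr (IH _ p'Gw) (hangsT x lx)) _.
exact: (pglue_graft (graft K1 L) [:: t]).
Qed.

Lemma Gw_exists Ts L : List.Forall2 hangs Ts L -> exists2 p, Gw Ts p & pisomorphic p (graft K1 L).
Proof.
move=> TsL; suff [p pGw] : exists p, Gw Ts p by exists p => //; apply: Gw_graft pGw.
elim: TsL => [|T t {}Ts {}L [[x lx] _] _ [p pGw]]; first by eexists; apply: Gw_nil.
by exists (glue x (point p)); apply: Gw_cons.
Qed.

(** The families allow any attaching vertex; after a rotation one fixed vertex is enough, and the
    cycle has to be counted at 0 only. *)
Lemma cycle_rotation k (c c' : cycle_graph k) : pisomorphic (PGraph c) (PGraph c').
Proof.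
have k0 : 0 < k by apply: leq_ltn_trans (ltn_ord c).
have lt_c := ltn_ord c.
(* The shift c' - c modulo k, kept nonnegative. *)
pose d := c' + (k - c).
pose f (x : cycle_graph k) : cycle_graph k := Ordinal (ltn_pmod (x + d) k0).
have f_mod (x : cycle_graph k) : f x = x + d %[mod k] by rewrite /= modn_mod.
have f_inj : injective f.
  move=> x y /(congr1 val) /= /eqP; rewrite eqn_modDr !modn_small ?ltn_ord // => /eqP E.
  exact: ord_inj.
exists f; split; first exact: injF_bij.
  move=> x y; rewrite /= /cycle_rel (inj_eq f_inj)
    /= -[in X in _ && X]addn1 -[X in _ || (X == _ %[mod _])]addn1.
  by rewrite !modnDml !modn_mod !addn1 -!addSn !eqn_modDr.
apply: ord_inj; rewrite /= /d addnCA subnKC ?modnDr ?modn_small //; exact: ltnW.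
Qed.

Lemma isomorphic_trans G H K : isomorphic G H -> isomorphic H K -> isomorphic G K.
Proof.
case=> f [bf fE] [g [bg gE]]; exists (g \o f); split; first exact: bij_comp.
by move=> x y /=; rewrite gE fE.
Qed.

Lemma pisomorphicW p q : pisomorphic p q -> isomorphic p q.
Proof. by case=> f [bf fE _]; exists f. Qed.

Definition plant L := foldr (fun Y X => Join X Y) Root L.

Lemma interp_plant L : interp (plant L) = graft K1 L.
Proof. by elim: L => //= T L ->. Qed.

Lemma children_plant L : children (plant L) = L.
Proof. by elim: L => //= T L ->. Qed.

Lemma hangs_nseq s : List.Forall2 hangs (nseq s (path_graph 4)) (nseq s P3e).
Proof. by elim: s => //= s IH; constructor=> //; apply: (hangs_path 2). Qed.

Lemma P4_K13_threes Ts : P4_K13_seq Ts ->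
  exists L, [/\ 0 < size L, threes L & List.Forall2 hangs Ts L].
Proof.
case=> Ts0 F; suff [L [sz L3 TsL]] : exists L, [/\ size L = size Ts,
  threes L & List.Forall2 hangs Ts L].
  by exists L; rewrite sz.
elim: F {Ts0} => [|T {}Ts TE _ [L [sz L3 TsL]]]; first by exists [::].
case: TE => ->.
  by exists (P3e :: L); split=> //=; [rewrite sz|constructor=> //; apply: (hangs_path 2)].
by exists (P3c :: L); split=> //=; [rewrite sz|constructor=> //; apply: hangs_claw].
Qed.

Lemma threes_P4_K13 L : 0 < size L -> threes L ->
  exists2 Ts, P4_K13_seq Ts & List.Forall2 hangs Ts L.
Proof.
move=> L0 L3; suff [Ts [sz F TsL]] : exists Ts, [/\ size Ts = size L,
    List.Forall (fun T => T = path_graph 4 \/ T = complete_bipartite 1 3)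
      Ts & List.Forall2 hangs Ts L].
  by exists Ts => //; split; rewrite ?sz.
elim: L L3 {L0} => [|T L IH] /=; first by exists [::].
case/andP=> /eqP T3 /IH[Ts [sz F TsL]].
have le3 : order T <= 3 by rewrite T3.
case: (order_le3 le3) T3 => [|[|[|]]] -> // _.
  exists (path_graph 4 :: Ts); split; rewrite /= ?sz //; first by constructor=> //; left.
  by constructor=> //; apply: (hangs_path 2).
exists (complete_bipartite 1 3 :: Ts); split; rewrite /= ?sz //; first by constructor=> //; right.
by constructor=> //; apply: hangs_claw.
Qed.

(** * The families as forests grafted on a cycle *)

Section Families.
Variables (k : nat) (G : sgraph).

Lemma cycle_link_graft p c T : pisomorphic p (interp T) ->
  is_cycle_link k p G <-> isomorphic G (graft (@PGraph (cycle_graph k) c) [:: T]).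
Proof.
move=> pT; have iso (c' : cycle_graph k) : pisomorphic (plink (PGraph c') p)
  (graft (@PGraph (cycle_graph k) c) [:: T]).
  exact: plink_congr (cycle_rotation _ _) pT.
split=> [[c' Gc']|Gc]; first exact: isomorphic_trans Gc' (pisomorphicW (iso c')).
by exists c; apply: isomorphic_trans Gc (pisomorphicW (pisomorphic_sym (iso c))).
Qed.

Lemma cycle_glue_graft p c L : pisomorphic p (graft K1 L) ->
  is_cycle_glue k p G <-> isomorphic G (graft (@PGraph (cycle_graph k) c) L).
Proof.
move=> pL; have iso (c' : cycle_graph k) : pisomorphic (pglue (PGraph c') p)
  (graft (@PGraph (cycle_graph k) c) L).
  apply: pisomorphic_trans (pglue_congr (cycle_rotation _ c) pL) _.
  exact: pglue_graft.
split=> [[c' Gc']|Gc]; first exact: isomorphic_trans Gc' (pisomorphicW (iso c')).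
by exists c; apply: isomorphic_trans Gc (pisomorphicW (pisomorphic_sym (iso c))).
Qed.

Variable c : cycle_graph k.
Let grafted L := isomorphic G (graft (PGraph c) L).

Lemma Gw_perm Ts L L' : List.Forall2 hangs Ts L' -> Permutation L L' ->
  exists2 p, Gw Ts p & pisomorphic p (graft K1 L).
Proof.
move=> TsL' LL'; have [p pGw pL'] := Gw_exists TsL'; exists p => //.
exact: pisomorphic_trans pL' (graft_perm _ (Permutation_sym LL')).
Qed.

Lemma family_G1P : family_G1 k G <-> exists2 L, extremal1 L & grafted L.
Proof.
split=> [[p pF Gp]|[L [T [s [-> TP]]] GL]].
  have [L LE pL] : exists2 L, (exists s, L = P2 :: nseq s P3e) & pisomorphic p (graft K1 L).
    case: pF => [[x lx ->]|[s s0 pGw]].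
      by exists [:: P2]; [exists 0|apply: (hangs_path 1).2].
    exists (P2 :: nseq s P3e); first by exists s.
    by apply: Gw_graft pGw; constructor; [apply: (hangs_path 1)|apply: hangs_nseq].
  exists [:: plant L].
    by have [s ->] := LE; exists (plant (P2 :: nseq s P3e)), s; rewrite children_plant.
  by apply/(cycle_link_graft (p := p)) => //; rewrite interp_plant.
(* Without any P_4 the tree is the bare P_3, which [tree_family1] lists separately, pointed at an
   end. *)
case: s TP => [|s] TP.
  have x_leaf : @leaf (path_graph 3) ord0 by rewrite path_leaf eqxx.
  exists (@PGraph (path_graph 3) ord0); first by left; exists ord0.
  apply/(cycle_link_graft c (T := T)) => //; rewrite interp_children.
  apply: pisomorphic_trans (graft_perm _ (Permutation_sym TP)).
  exact: (hangs_path 1).2.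
have [|p pGw pT] := @Gw_perm (path_graph 3 :: nseq s.+1 (path_graph 4)) _ _ _ TP.
  by constructor; [apply: (hangs_path 1)|apply: hangs_nseq].
exists p; first by right; exists s.+1.
by apply/(cycle_link_graft c (T := T)); rewrite // interp_children.
Qed.

Lemma family_G2P : family_G2 k G <-> exists2 L, extremal2 L & grafted L.
Proof.
split=> [[p pF Gp]|[L [T [L' [-> L'3 TP]]] GL]].
  have [L L3 pL] : exists2 L, threes L & pisomorphic p (graft K1 (Root :: P2 :: L)).
    case: pF => [pGw|[Ts /P4_K13_threes[L [L0 L3 TsL]] pGw]]; [exists [::] => //|exists L => //];
    apply: Gw_graft pGw;
    by constructor; [apply: (hangs_path 0)|constructor=> //; apply: (hangs_path 1)].
  exists [:: plant (Root :: P2 :: L)].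
    by exists (plant (Root :: P2 :: L)), L; rewrite children_plant.
  by apply/(cycle_link_graft (p := p)) => //; rewrite interp_plant.
suff [p pF pT] : exists2 p, tree_family2 p & pisomorphic p (graft K1 (children T)).
  by exists p => //; apply/(cycle_link_graft c (T := T)); rewrite // interp_children.
have [/size0nil L'0|] := posnP (size L').
  have [|p pGw pT] := @Gw_perm [:: path_graph 2; path_graph 3] _ _ _ TP; last by exists p => //;
    left.
  by rewrite L'0; constructor; [apply: (hangs_path 0)|constructor=> //; apply: (hangs_path 1)].
move=> L'0; have [Ts Ts4 TsL'] := threes_P4_K13 L'0 L'3.
have [|p pGw pT] := @Gw_perm [:: path_graph 2, path_graph 3 & Ts] _ _ _ TP.
  by constructor; [apply: (hangs_path 0)|constructor=> //; apply: (hangs_path 1)].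
by exists p => //; right; exists Ts.
Qed.

Lemma family_G6P : family_G6 k G <-> exists2 L, extremal6 L & grafted L.
Proof.
split=> [[Ts [p [/P4_K13_threes[L [L0 L3 TsL]] pGw Gp]]]|[L [L' [L'0 L'3 LL']] GL]].
  exists (P2 :: L); first by exists L.
  apply/(cycle_glue_graft (p := p)) => //; apply: Gw_graft pGw.
  by constructor=> //; apply: (hangs_path 1).
have [Ts Ts4 TsL'] := threes_P4_K13 L'0 L'3.
have [|p pGw pL] := @Gw_perm (path_graph 3 :: Ts) _ _ _ LL'.
  by constructor=> //; apply: (hangs_path 1).
by exists Ts, p; split=> //; apply/(cycle_glue_graft c pL).
Qed.

Lemma family_G7P : family_G7 k G <-> exists2 L, extremal7 L & grafted L.
Proof.
split=> [[Ts [p [/P4_K13_threes[L [L0 L3 TsL]] pGw Gp]]]|[L [L' [L'0 L'3 LL']] GL]].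
  exists (Root :: Root :: L); first by exists L.
  apply/(cycle_glue_graft (p := p)) => //; apply: Gw_graft pGw.
  by constructor; [apply: (hangs_path 0)|constructor=> //; apply: (hangs_path 0)].
have [Ts Ts4 TsL'] := threes_P4_K13 L'0 L'3.
have [|p pGw pL] := @Gw_perm [:: path_graph 2, path_graph 2 & Ts] _ _ _ LL'.
  by constructor; [apply: (hangs_path 0)|constructor=> //; apply: (hangs_path 0)].
by exists Ts, p; split=> //; apply/(cycle_glue_graft c pL).
Qed.

Lemma family_G8P : family_G8 k G <-> exists2 L, extremal8 L & grafted L.
Proof.
split=> [[s [p [s0 pGw Gp]]]|[L [s s0 LL'] GL]].
  exists (nseq s P3e); first by exists s.
  by apply/(cycle_glue_graft (p := p)) => //; apply: Gw_graft pGw; apply: hangs_nseq.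
have [p pGw pL] := Gw_perm (hangs_nseq s) LL'.
by exists s, p; split=> //; apply/(cycle_glue_graft c pL).
Qed.

Lemma family_G9P : family_G9 k G <-> exists2 L, extremal9 L & grafted L.
Proof.
split=> [[Ts [p [/P4_K13_threes[L [L0 L3 TsL]] pGw Gp]]]|[L [L' [L'0 L'3 LL']] GL]].
  exists (Root :: L); first by exists L.
  apply/(cycle_glue_graft (p := p)) => //; apply: Gw_graft pGw.
  by constructor=> //; apply: (hangs_path 0).
have [Ts Ts4 TsL'] := threes_P4_K13 L'0 L'3.
have [|p pGw pL] := @Gw_perm (path_graph 2 :: Ts) _ _ _ LL'.
  by constructor=> //; apply: (hangs_path 0).
by exists Ts, p; split=> //; apply/(cycle_glue_graft c pL).
Qed.

End Families.

Section GeneratingPolynomials.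
Import GRing.Theory.
Local Open Scope ring_scope.

(** * Counting dissociation sets by size *)

Definition sdeg (G : sgraph) (S : {set G}) (x : G) : nat := #|[set y in S | x -- y]|.

Lemma dissociationP (G : sgraph) (S : {set G}) :
  reflect (forall x, x \in S -> (sdeg S x <= 1)%N) (dissociation S).
Proof. exact: forall_inP. Qed.

Definition size_poly_of (T : finType) (P : pred {set T}) : {poly nat} :=
  \sum_(S : {set T} | P S) 'X^#|S|.

Section States.
Variable p : pgraph.
Implicit Type S : {set p}.
Definition outS S := dissociation S && (point p \notin S).
Definition isoS S := [&& dissociation S, point p \in S & sdeg S (point p) == 0%N].
Definition matS S := [&& dissociation S, point p \in S & sdeg S (point p) == 1%N].
End States.

(* [a] may vanish, so the degree of P may be smaller than d. *)
Definition top_coef (P : {poly nat}) d a := P`_d = a /\ forall j, (d < j)%N -> P`_j = 0.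

Lemma topD P Q d a b : top_coef P d a -> top_coef Q d b -> top_coef (P + Q) d (a + b).
Proof.
by case=> <- P0 [<- Q0]; split=> [|j dj]; rewrite coefD // P0 ?Q0.
Qed.

(** Declaring a size one too large turns the count into 0. In this way the sorts that fall short of
    the maximum drop out of sums, and the zeros in [pjoin] arise. *)
Lemma topS P d a : top_coef P d a -> top_coef P d.+1 0.
Proof. by case=> _ P0; split=> [|j dj]; apply: P0 => //; apply: ltnW. Qed.

Lemma topM P Q d e a b : top_coef P d a -> top_coef Q e b -> top_coef (P * Q) (d + e) (a * b).
Proof.
case=> <- P0 [<- Q0].
have zero j (i : 'I_j.+1) : (d + e <= j)%N -> (i != d :> nat)
  || (d + e < j)%N -> P`_i * Q`_(j - i) = 0.
  move=> le_j Ni; have [lt_di|le_id] := ltnP d i; first by rewrite P0 // mul0r.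
  by rewrite Q0 ?mulr0 //; have := ltn_ord i; case/orP: Ni => /=; lia.
split=> [|j lt_j]; rewrite coefM.
  have lt_d : (d < (d + e).+1)%N by lia.
  rewrite (bigD1 (Ordinal lt_d)) //= big1 ?addr0 ?addKn // => i.
  by rewrite -val_eqE /= => Ni; rewrite zero // Ni.
by rewrite big1 // => i _; rewrite zero ?lt_j ?orbT //; apply: ltnW.
Qed.

Section Link.
Variables p q : pgraph.
Let u := point p.
Let v := point q.

Definition sum_set (S1 : {set p}) (S2 : {set q}) : {set plink p q} :=
  [set z | match z with inl x => x \in S1 | inr y => y \in S2 end].

Lemma card_sum_pred (A B : finType) (P : pred (A + B)) :
  #|[set z | P z]| = (#|[set x | P (inl x)]| + #|[set y | P (inr y)]|)%N.
Proof.
rewrite -!sum1_card big_sumType /=.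
by congr (_ + _)%N; apply: eq_bigl => x; rewrite !inE.
Qed.

Lemma card_sum_set S1 S2 : #|sum_set S1 S2| = (#|S1| + #|S2|)%N.
Proof. by rewrite card_sum_pred; congr (_ + _)%N; apply: eq_card => x; rewrite inE. Qed.

Lemma sdeg_inl S1 S2 x :
  sdeg (sum_set S1 S2) (inl x) = (sdeg S1 x + ((x == u) && (v \in S2)))%N.
Proof.
rewrite /sdeg card_sum_pred; congr (_ + _)%N.
  by apply: eq_card => y; rewrite !inE.
have [/= xu|Nxu] := boolP (x == u); last first.
  by rewrite (eq_card0 (A := [set _ | _])) // => y; rewrite !inE /= (negbTE Nxu) andbF.
rewrite (eq_card (B := [pred y | (y == v) && (v \in S2)])) => [|y]; last first.
  by rewrite !inE /= xu /=; case: eqP => [->|]; rewrite ?andbT ?andbF.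
case: (v \in S2); last by rewrite eq_card0 // => y; rewrite !inE ?andbF.
by rewrite (eq_card (B := pred1 v)) ?card1 // => y; rewrite !inE ?andbT.
Qed.

Lemma sdeg_inr S1 S2 y :
  sdeg (sum_set S1 S2) (inr y) = (sdeg S2 y + ((y == v) && (u \in S1)))%N.
Proof.
rewrite /sdeg card_sum_pred addnC; congr (_ + _)%N.
  by apply: eq_card => x; rewrite !inE.
have [/= yv|Nyv] := boolP (y == v); last first.
  by rewrite (eq_card0 (A := [set _ | _])) // => x; rewrite !inE /= (negbTE Nyv) !andbF.
rewrite (eq_card (B := [pred x | (x == u) && (u \in S1)])) => [|x]; last first.
  by rewrite !inE /= yv /= ?andbT; case: eqP => [->|]; rewrite ?andbT ?andbF.
case: (u \in S1); last by rewrite eq_card0 // => x; rewrite !inE ?andbF.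
by rewrite (eq_card (B := pred1 u)) ?card1 // => x; rewrite !inE ?andbT.
Qed.

(** The new edge raises the degrees of u and v by one, and only if both are chosen; both must then
    have had degree 0. *)
Lemma dissociation_link S1 S2 : dissociation (sum_set S1 S2) =
  [&& dissociation S1, dissociation S2 &
      (u \in S1) && (v \in S2) ==> (sdeg S1 u == 0%N) && (sdeg S2 v == 0%N)].
Proof.
apply/dissociationP/and3P => [D|[/dissociationP D1 /dissociationP D2 uv] [x|y]].
- split; last 1 first.
  + apply/implyP => /andP[uS vS].
    have := D (inl u); have := D (inr v); rewrite !inE sdeg_inl sdeg_inr !eqxx uS vS /=.
    by move=> /(_ isT) + /(_ isT); lia.
  + by apply/dissociationP => x xS; have := D (inl x); rewrite inE xS sdeg_inl => /(_ isT); lia.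
  + by apply/dissociationP => x xS; have := D (inr x); rewrite inE xS sdeg_inr => /(_ isT); lia.
- rewrite inE => xS; rewrite sdeg_inl; have := D1 _ xS; move: uv; case: (x =P u) => [<-|_];
    last by rewrite /= addn0.
  by rewrite xS /=; case: (v \in S2) => /=; lia.
- rewrite inE => yS; rewrite sdeg_inr; have := D2 _ yS; move: uv; case: (y =P v) => [<-|_];
    last by rewrite /= addn0.
  by rewrite yS /= andbT; case: (u \in S1) => /=; lia.
Qed.

Lemma size_poly_link (R : pred {set plink p q}) (P : pred {set p}) (Q : pred {set q}) :
  (forall S1 S2, R (sum_set S1 S2) = P S1 && Q S2) ->
  size_poly_of R = size_poly_of P * size_poly_of Q.
Proof.
move=> RE; rewrite /size_poly_of big_distrlr /= pair_big /=.
rewrite (reindex (fun S => sum_set S.1 S.2)) /=.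
  by apply: eq_big => [S|S _]; rewrite ?RE // card_sum_set exprD.
exists (fun S : {set plink p q} => ([set x | inl x \in S], [set y | inr y \in S])) =>
  [[S1 S2] _|S _] /=.
  by congr (_, _); apply/setP => x; rewrite !inE.
by apply/setP => -[x|x]; rewrite !inE.
Qed.

Lemma outS_link S1 S2 : outS (sum_set S1 S2) = outS S1 && dissociation S2.
Proof.
rewrite /outS dissociation_link inE /= -/u.
by case: (dissociation S1); case: (dissociation S2); case: (u \in S1); case: (v \in S2);
  rewrite /= ?andbF.
Qed.

Lemma isoS_link S1 S2 : isoS (sum_set S1 S2) = isoS S1 && outS S2.
Proof.
rewrite /isoS /outS dissociation_link inE /= -/u -/v sdeg_inl eqxx /=.
by case: (dissociation S1); case: (dissociation S2); case: (u \in S1); case: (v \in S2) => //=; lia.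
Qed.

Lemma matS_link0 S1 S2 : matS (sum_set S1 S2) && (inr v \notin sum_set S1 S2) = matS S1 && outS S2.
Proof.
rewrite /matS /outS dissociation_link !inE /= -/u -/v sdeg_inl eqxx /=.
by case: (dissociation S1); case: (dissociation S2); case: (u \in S1); case: (v \in S2) => //=; lia.
Qed.

Lemma matS_link1 S1 S2 : matS (sum_set S1 S2) && (inr v \in sum_set S1 S2) = isoS S1 && isoS S2.
Proof.
rewrite /matS /isoS dissociation_link !inE /= -/u -/v sdeg_inl eqxx /=.
by case: (dissociation S1); case: (dissociation S2); case: (u \in S1); case: (v \in S2) => //=; lia.
Qed.

Lemma out_poly_link : size_poly_of (@outS (plink p q)) =
  size_poly_of (@outS p) * size_poly_of (@dissociation q).
Proof. exact: size_poly_link outS_link. Qed.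

Lemma iso_poly_link : size_poly_of (@isoS (plink p q)) =
  size_poly_of (@isoS p) * size_poly_of (@outS q).
Proof. exact: size_poly_link isoS_link. Qed.

Lemma mat_poly_link : size_poly_of (@matS (plink p q)) =
  size_poly_of (@matS p) * size_poly_of (@outS q) + size_poly_of (@isoS p) * size_poly_of (@isoS q).
Proof.
rewrite {1}/size_poly_of (bigID (fun S : {set plink p q} => inr v \notin S)) /=; congr (_ + _).
  exact: size_poly_link matS_link0.
rewrite (eq_bigl (fun S : {set plink p q} => matS S && (inr v \in S))) => [|S];
  last by rewrite negbK.
exact: size_poly_link matS_link1.
Qed.

End Link.

Lemma dissociation_poly (p : pgraph) : size_poly_of (@dissociation p) =
  size_poly_of (@outS p) + (size_poly_of (@isoS p) + size_poly_of (@matS p)).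
Proof.
rewrite /size_poly_of (bigID (fun S : {set p} => point p \notin S)) /=; congr (_ + _).
rewrite (bigID (fun S : {set p} => sdeg S (point p) == 0%N)) /=; congr (_ + _); apply: eq_bigl => S.
  by rewrite /isoS negbK andbA.
rewrite /matS negbK; have [/dissociationP D|//] := boolP (dissociation S).
by case: (boolP (point p \in S)) => //= pS; have := D _ pS; lia.
Qed.

Definition realizes (p : pgraph) (x : profile) d :=
  let: Profile k a b c := x in
  [/\ top_coef (size_poly_of (@outS p)) d a,
      top_coef (size_poly_of (@isoS p)) (d + (if k is Alone then 1 else 0)) b
    & top_coef (size_poly_of (@matS p)) (d + (if k is Level then 0 else 1)) c].

Lemma realizes_total p x d : realizes p x d ->
  top_coef (size_poly_of (@dissociation p)) (d + (if pkind x is Level then 0 else 1)) (ptotal x).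
Proof.
rewrite dissociation_poly; case: x => -[] a b c [pa pb pc]; rewrite /ptotal /=.
- by rewrite -addnA addn0 in pb pc *; apply: topD => //; apply: topD.
- by rewrite addn0 addn1 in pb pc *; apply: (topD (topS pa)); apply: (topD (topS pb)).
- by rewrite addn1 in pb pc *; apply: (topD (topS pa)); apply: topD.
Qed.

Lemma topD_eq P Q d a b c : top_coef P d a -> top_coef Q d b -> (a + b)%N = c -> top_coef (P + Q)
  d c.
Proof. by move=> tP tQ <-; apply: topD. Qed.

Lemma realizes_link p q x y d e : realizes p x d -> realizes q y e ->
  exists f, realizes (plink p q) (pjoin x y) f.
Proof.
move=> px qy; have qt := realizes_total qy; move: px qy qt.
case: x => kx a b c; case: y => ky a' b' c' [pa pb pc] [qa qb _] qt.
(* A set avoiding the point of the link is a set avoiding the point of [p] together with any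
   dissociation set of [q]; the second summand is the size that [realizes_total] gives for the
   latter. *)
exists (d + (e + (if ky is Level then 0 else 1)))%N.
rewrite /realizes /pjoin out_poly_link iso_poly_link mat_poly_link.
have := topM pa qt; have := topM pb qa; have := topM pc qa; have := topM pb qb.
case: kx {pa pb pc}; case: ky {qa qb qt} => /=;
  rewrite ?addn0 ?addn1 ?addnS ?addSn => mbb mca mba mat; split=> //.
all: first
  [ exact: mat | exact: mba | exact: (topS mba)
  | by apply: (topD_eq mca mbb) | by apply: (topD_eq mca (topS mbb)); rewrite addn0
  | by apply: (topD_eq (topS mca) mbb) | by apply: (topD_eq (topS mca) (topS mbb)) ].
Qed.

Lemma coef_size_poly (T : finType) (P : pred {set T}) j :
  (size_poly_of P)`_j = #|[set S | P S & #|S| == j]|.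
Proof.
rewrite /size_poly_of coef_sum (eq_bigr (fun S : {set T} => if #|S| == j then 1 else 0)) => [|S _].
  by rewrite -big_mkcondr /= -sum1_card; apply: eq_bigl => S; rewrite inE.
by rewrite coefXn eq_sym; case: eqP.
Qed.

(** A positive coefficient ensures that size d is attained; [top_coef] alone only bounds the sizes
    from above. *)
Lemma num_max_dissociation_top (G : sgraph) d m : (0 < m)%N ->
  top_coef (size_poly_of (@dissociation G)) d m -> num_max_dissociation G = m.
Proof.
move=> m0 []; rewrite coef_size_poly => mE above.
rewrite -mE /num_max_dissociation; apply: eq_card => S; rewrite !inE /max_dissociation.
have le_d (S' : {set G}) : dissociation S' -> (#|S'| <= d)%N.
  move=> dS'; rewrite leqNgt; apply/negP=> /above; rewrite coef_size_poly => /eqP.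
  by rewrite cards_eq0 => /eqP/setP/(_ S'); rewrite !inE dS' eqxx.
have [S0] : exists S0 : {set G}, S0 \in [set S0 | dissociation S0 & #|S0| == d].
  by apply/set0Pn; rewrite -card_gt0 mE.
rewrite inE => /andP[dS0 /eqP S0d].
have [dS|//] := boolP (dissociation S); rewrite /=.
apply/forallP/eqP => [/(_ S0)|Sd S']; last by apply/implyP => /le_d; rewrite Sd.
by rewrite dS0 S0d /= => le_dS; apply/eqP; rewrite eqn_leq le_d.
Qed.

Section Iso.
Variables (G H : sgraph) (f : G -> H).
Hypotheses (f_bij : bijective f) (fE : forall x y, f x -- f y = x -- y).
Let f_inj := bij_inj f_bij.

Lemma sdeg_iso (S : {set G}) x : sdeg (f @: S) (f x) = sdeg S x.
Proof.
rewrite /sdeg -(card_imset _ f_inj); apply: eq_card => z.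
have [g fK gK] := f_bij; rewrite -(gK z) inE !mem_imset // inE.
by rewrite fE.
Qed.

Lemma dissociation_iso (S : {set G}) : dissociation (f @: S) = dissociation S.
Proof.
apply/dissociationP/dissociationP => D x.
  by move=> xS; rewrite -sdeg_iso; apply: D; rewrite mem_imset.
by case/imsetP=> y yS ->; rewrite sdeg_iso; apply: D.
Qed.

Lemma size_poly_iso (P : pred {set G}) (Q : pred {set H}) :
  (forall S : {set G}, Q (f @: S) = P S) -> size_poly_of Q = size_poly_of P.
Proof.
move=> QP; have [g fK gK] := f_bij; rewrite /size_poly_of.
rewrite (reindex (fun S : {set G} => f @: S)) /=; last first.
  exists (fun S : {set H} => g @: S) => S _; rewrite -imset_comp.
    by rewrite (eq_imset (g := id)) ?imset_id.
  by rewrite (eq_imset (g := id)) ?imset_id.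
by apply: eq_big => [S|S _]; rewrite ?QP ?card_imset.
Qed.

End Iso.

Lemma num_max_dissociation_iso (G H : sgraph) d m : isomorphic G H -> (0 < m)%N ->
  top_coef (size_poly_of (@dissociation H)) d m -> num_max_dissociation G = m.
Proof.
case=> f [f_bij fE] m0 tH; apply: (@num_max_dissociation_top _ d) => //.
by rewrite -(size_poly_iso f_bij (dissociation_iso f_bij fE)).
Qed.

Lemma realizes_iso p q x d : pisomorphic p q -> realizes p x d -> realizes q x d.
Proof.
case=> f [f_bij fE fp]; have f_inj := bij_inj f_bij; case: x => k a b c.
rewrite /realizes (size_poly_iso (Q := @outS q) (P := @outS p) f_bij); last first.
  by move=> S; rewrite /outS dissociation_iso // -fp mem_imset.
rewrite (size_poly_iso (Q := @isoS q) (P := @isoS p) f_bij); last first.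
  by move=> S; rewrite /isoS dissociation_iso // -fp mem_imset // sdeg_iso.
rewrite (size_poly_iso (Q := @matS q) (P := @matS p) f_bij) // => S.
by rewrite /matS dissociation_iso // -fp mem_imset // sdeg_iso.
Qed.

Lemma topXn n : top_coef 'X^n n 1.
Proof.
by split=> [|j lt_nj]; rewrite coefXn ?eqxx // gtn_eqF.
Qed.

Lemma top0 d : top_coef 0 d 0.
Proof. by split=> *; rewrite coef0. Qed.

Lemma realizes_K1 : realizes K1 (Profile Alone 1 1 0) 0.
Proof.
have sdeg0 (S : {set K1}) x : sdeg S x = 0%N.
  by apply: eq_card0 => y; rewrite !inE [x]ord1 [y]ord1 andbF.
have D (S : {set K1}) : dissociation S by apply/dissociationP => x _; rewrite sdeg0.
have set0E (S : {set K1}) : (point K1 \notin S) = (S == set0).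
  apply/idP/eqP => [NS|->]; last by rewrite inE.
  by apply/setP=> x; rewrite inE [x]ord1; apply/negbTE.
have setTE (S : {set K1}) : (point K1 \in S) = (S == setT).
  apply/idP/eqP => [NS|->]; last by rewrite inE.
  by apply/setP=> x; rewrite inE [x]ord1.
split; rewrite /size_poly_of.
- rewrite (big_pred1 set0) => [|S]; last by rewrite /outS D set0E.
  by rewrite cards0; apply: topXn.
- rewrite (big_pred1 setT) => [|S]; last by rewrite /isoS D setTE sdeg0 andbT.
  by rewrite cardsT card_ord; apply: topXn.
- by rewrite big_pred0 => [|S]; [apply: top0|rewrite /matS sdeg0 !andbF].
Qed.

Lemma realizes_interp T : exists d, realizes (interp T) (prof T) d.
Proof.
elim: T => [|X [d dX] Y [e eY]] /=; first by exists 0%N; apply: realizes_K1.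
exact: realizes_link dX eY.
Qed.

Lemma realizes_graft p x d L : realizes p x d -> exists e, realizes (graft p L) (pjoins x L) e.
Proof.
move=> px; elim: L => [|T L [e eL]] /=; first by exists d.
by have [h hT] := realizes_interp T; apply: realizes_link eL hT.
Qed.

(** The clause on [Alone] is needed for the induction: two [Alone] trees join to a [Paired] one
    whose total is the product of their [pisol]. *)
Lemma prof_pos T : let x := prof T in (0 < pout x)%N && (0 < ptotal x)%N &&
  (if pkind x is Alone then (0 < pisol x)%N else true).
Proof.
elim: T => //= X + Y.
case: (prof X) => -[] a b c; case: (prof Y) => -[] a' b' c';
  rewrite /pjoin /ptotal /= ?addn_gt0 ?muln_gt0 ?addn_gt0; lia.
Qed.

Lemma potted_profile_pos t L : (0 < ptotal (potted_profile t L))%N.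
Proof.
suff: pkind (potted_profile t L) = Level /\ (0 < pout (potted_profile t L))%N.
  by case: (potted_profile t L) => -[] a b c [//= _ a0]; rewrite /ptotal /=; lia.
elim: L => // T L; rewrite {2 4}/potted_profile /= -/(potted_profile t L).
have := prof_pos T; case: (potted_profile t L) => -[] a b c; case: (prof T) => -[] a' b' c';
  rewrite /pjoin /ptotal /= ?addn_gt0 ?muln_gt0 ?addn_gt0 => H [] // _ a0; split=> //; lia.
Qed.

(** * The profile of a cycle *)

(** The generating polynomial, by number of ones, of the bit sequences of length n satisfying P. The
    recursive form makes splitting off the first bit a matter of computation. *)
Fixpoint bit_poly n (P : bitseq -> bool) : {poly nat} :=
  if n is m.+1 then 'X * bit_poly m (fun s => P (true :: s)) + bit_poly m (fun s => P (false :: s))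
  else if P [::] then 1 else 0.

Lemma eq_bit_poly n P Q : (forall s, size s = n -> P s = Q s) -> bit_poly n P = bit_poly n Q.
Proof.
elim: n P Q => [|n IH] P Q PQ /=; first by rewrite PQ.
by congr ('X * _ + _); apply: IH => s sz; apply: PQ; rewrite /= sz.
Qed.

Lemma bit_poly0 n P : (forall s, size s = n -> P s = false) -> bit_poly n P = 0.
Proof.
move=> P0; rewrite (eq_bit_poly (Q := fun _ => false)) {P0}//.
by elim: n => //= n ->; rewrite mulr0 addr0.
Qed.

(** On the cycle, the last bit belongs to the predecessor of the point. *)
Lemma bit_poly_rcons n P :
  bit_poly n.+1 P = 'X * bit_poly n (fun s => P (rcons s true)) + bit_poly n (fun s =>
    P (rcons s false)).
Proof.
elim: n P => [|n IH] P //.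
have -> : bit_poly n.+2 P = 'X * bit_poly n.+1 (fun s => P (true :: s))
  + bit_poly n.+1 (fun s => P (false :: s)) by [].
rewrite (IH (fun s => P (true :: s))) (IH (fun s => P (false :: s))) /= !mulrDr !addrA;
  congr (_ + _).
by rewrite -!addrA; congr (_ + _); rewrite addrC.
Qed.

(* A set of vertices of a path is a dissociation set iff it contains no three
   consecutive vertices; for a cycle this is tested on the cyclic bit sequence
   prolonged by its first two bits ([cyclic_no111]). *)
Fixpoint no111 (s : bitseq) :=
  if s is a :: s' then ~~ [&& a, nth false s' 0 & nth false s' 1] && no111 s' else true.

Lemma no111P s : reflect
  (forall i, ~~ [&& nth false s i, nth false s i.+1 & nth false s i.+2]) (no111 s).
Proof.
elim: s => [|a s IH] /=; first by left=> i; rewrite !nth_nil.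
apply: (iffP andP) => [[s0 /IH s1] [|i]|s1] //=.
by split; [have := s1 0%N|apply/IH => i; have := s1 i.+1].
Qed.

Lemma nth_rcons_false s i : nth false (rcons s false) i = nth false s i.
Proof.
rewrite nth_rcons; case: ltngtP => // [lt_i|->]; first by rewrite nth_default // ltnW.
by rewrite nth_default.
Qed.

Lemma no111_rcons_false s : no111 (rcons s false) = no111 s.
Proof. by apply/no111P/no111P => H i; have := H i; rewrite !nth_rcons_false. Qed.

Lemma no111_false_any s b : no111 (s ++ [:: false; b]) = no111 s.
Proof.
elim: s => [|a s IH] /=; first by rewrite !andbF.
by rewrite IH; case: s {IH} => [|a' [|a'' s]] //=; rewrite ?andbF.
Qed.

Lemma no111_false_any2 s b b' : no111 (s ++ [:: false; b; b']) = no111 s.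
Proof.
elim: s => [|a s IH] /=; first by rewrite !andbF.
by rewrite IH; case: s {IH} => [|a' [|a'' s]] //=; rewrite ?andbF.
Qed.

(** The sequence starts with 0, 10 or 110, and after this zero the rest is an arbitrary sequence
    without 111. *)
Lemma bit_poly_no111_rec n : bit_poly n.+3 no111 = bit_poly n.+2 no111 + 'X * bit_poly n.+1 no111
  + 'X^2 * bit_poly n no111.
Proof.
rewrite [LHS]/= -!/(bit_poly _ _).
rewrite (bit_poly0 (n := n) (P := fun s => no111 [:: true, true, true & s])) // mulr0 add0r.
rewrite (eq_bit_poly (n := n) (P := fun s => no111 [:: true, true, false & s]) (Q := no111)) //.
rewrite [bit_poly n.+2 _]/= [bit_poly n.+1 _]/=.
rewrite (eq_bit_poly (n := n) (P := fun s => no111 [:: true, false, true & s]) (Q := fun s =>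
  no111 (true :: s))) //.
rewrite (eq_bit_poly (n := n) (P := fun s => no111 [:: true, false, false & s]) (Q := fun s =>
  no111 (false :: s))) //.
rewrite expr2 mulrDr -mulrA [RHS]addrC -addrA; congr (_ + _); exact: addrC.
Qed.

Lemma topX_mul P d a : top_coef P d a -> top_coef ('X * P) d.+1 a.
Proof.
by case=> Pd P0; split=> [|[|j]]; rewrite coefXM //=; apply: P0.
Qed.

(** Paths by their order modulo 3. By the recursion, a count of full size is the sum of those
    predecessors that reach it. The first count stays unspecified: only its size 2s enters the other
    two. *)
Lemma top_no111 s : exists e,
  [/\ top_coef (bit_poly (3 * s) no111) (2 * s) e, top_coef (bit_poly (3 * s).+1 no111)
    (2 * s).+1 s.+1
    & top_coef (bit_poly (3 * s).+2 no111) (2 * s).+2 1].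
Proof.
elim: s => [|s [e [t0 t1 t2]]].
  exists 1%N; rewrite muln0 /= !mulr1; split.
  - exact: (topXn 0).
  - by apply: topD_eq (topXn 1) (topS (topXn 0)) _.
  - rewrite mulrDr mulr1 -expr2.
    by apply: topD_eq (topD_eq (topXn 2) (topS (topXn 1)) _) (topS (topD_eq (topXn 1)
      (topS (topXn 0)) _)) _.
have step n d a b c : top_coef (bit_poly n.+2 no111) d.+2 a -> top_coef (bit_poly n.+1 no111)
  d.+1 b ->
    top_coef (bit_poly n no111) d c -> top_coef (bit_poly n.+3 no111) d.+2 (a + b + c).
  move=> ta tb tc; rewrite bit_poly_no111_rec exprS expr1 -mulrA.
  by apply: topD; [apply: topD|]; rewrite ?expr1 //; do ?apply: topX_mul.
have e0 := step _ _ _ _ _ t2 t1 t0.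
have e1 := step _ _ _ _ _ (topS e0) t2 t1.
have e2 := step _ _ _ _ _ (topS e1) (topS e0) t2.
exists (1 + s.+1 + e)%N; rewrite !mulnS; split; rewrite ?addSn ?add0n.
- by [].
- by have -> : s.+2 = (0 + 1 + s.+1)%N by lia.
- by [].
Qed.

Fixpoint bitseqs n : seq bitseq :=
  if n is m.+1 then map (cons true) (bitseqs m) ++ map (cons false) (bitseqs m) else [:: [::]].

Lemma mem_bitseqs n s : (s \in bitseqs n) = (size s == n).
Proof.
elim: n s => [|n IH] [|b s] //=; rewrite mem_cat.
  by apply/negP=> /orP[] /mapP[].
have inj c : injective (cons c : bitseq -> bitseq) by move=> x y [].
have Nmem c : c != b -> ((b :: s) \in map (cons c) (bitseqs n)) = false.
  by move=> Ncb; apply/negP => /mapP[s' _ [bc _]]; rewrite bc eqxx in Ncb.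
by case: b Nmem => Nmem; [rewrite (Nmem false)|rewrite (Nmem true)];
  rewrite //= ?orbF mem_map // IH eqSS.
Qed.

Lemma bitseqs_uniq n : uniq (bitseqs n).
Proof.
elim: n => //= n IH; rewrite cat_uniq !map_inj_uniq ?IH //=; try by move=> x y [].
by rewrite andbT; apply/hasPn => _ /mapP[s _ ->]; apply/negP=> /mapP[].
Qed.

Lemma bit_polyE n P : bit_poly n P = \sum_(s <- bitseqs n | P s) 'X^(count id s).
Proof.
elim: n P => [|n IH] P; first by rewrite /= big_cons big_nil; case: (P _); rewrite ?addr0.
rewrite [LHS]/= !IH big_cat /= !big_map; congr (_ + _).
by rewrite big_distrr /=; apply: eq_bigr => s _; rewrite add1n exprS.
Qed.

Definition bits n (S : {set 'I_n}) : bitseq := [seq i \in S | i <- enum 'I_n].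

Lemma size_bits n (S : {set 'I_n}) : size (bits S) = n.
Proof. by rewrite size_map size_enum_ord. Qed.

Lemma nth_bits n (S : {set 'I_n}) (i : 'I_n) : nth false (bits S) i = (i \in S).
Proof. by rewrite (nth_map i) ?size_enum_ord // nth_ord_enum. Qed.

Lemma bits_inj n : injective (@bits n).
Proof. by move=> S S' SS'; apply/setP=> i; rewrite -!nth_bits SS'. Qed.

Lemma bits_surj n s : size s = n -> exists S : {set 'I_n}, bits S = s.
Proof.
move=> sz; exists [set i : 'I_n | nth false s i].
apply: (@eq_from_nth _ false) => [|i]; first by rewrite size_bits.
by rewrite size_bits => lt_i; rewrite (nth_bits _ (Ordinal lt_i)) inE.
Qed.

Lemma size_poly_bits n (P : pred {set 'I_n}) (Q : bitseq -> bool) :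
  (forall S, P S = Q (bits S)) -> size_poly_of P = bit_poly n Q.
Proof.
move=> PQ; rewrite bit_polyE /size_poly_of.
have E : perm_eq (map (@bits n) (enum {set 'I_n})) (bitseqs n).
  apply: uniq_perm; [by rewrite map_inj_uniq ?enum_uniq //; apply: bits_inj|exact: bitseqs_uniq|].
  move=> s; rewrite mem_bitseqs; apply/mapP/eqP => [[S _ ->]|/bits_surj[S <-]];
    first exact: size_bits.
  by exists S; rewrite ?mem_enum.
rewrite -(perm_big _ E) big_map big_enum_cond /=.
apply: eq_big => [S|S _]; first by rewrite PQ.
by rewrite count_map -sum1_count big_enum_cond /= -sum1_card; congr 'X^_; apply: eq_bigl.
Qed.

Section Cycle.
Variable m : nat.
Let k := m.+4.
Implicit Type S : {set 'I_k}.

Lemma ordS_val (x : 'I_k) : ordS x = (if x == m.+3 :> nat then 0 else x.+1)%N :> nat.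
Proof.
have lt_x := ltn_ord x; rewrite /=.
by case: eqP => [->|Nx]; rewrite ?modnn // modn_small //; lia.
Qed.

Lemma ord_pred_val (x : 'I_k) : ord_pred x = (if x == 0 :> nat then m.+3 else x.-1)%N :> nat.
Proof.
have lt_x := ltn_ord x; rewrite /=.
case: eqP => [->|Nx]; first by rewrite ?add0n modn_small.
have -> : ((x + k).-1 = x.-1 + k)%N by lia.
by rewrite modnDr modn_small //; lia.
Qed.

Lemma cycle_edge (x y : 'I_k) : cycle_rel x y = (y == ordS x) || (y == ord_pred x).
Proof.
have lt_x := ltn_ord x; have lt_y := ltn_ord y.
rewrite /cycle_rel -!val_eqE /= -/(ordS x) -/(ordS y) -/(ord_pred x).
rewrite (modn_small lt_x) (modn_small lt_y) [(_ %% _)%N](ordS_val x).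
rewrite [(y.+1 %% _)%N](ordS_val y) [((x + k).-1 %% _)%N](ord_pred_val x).
by case: ifP; case: ifP; case: ifP; lia.
Qed.

Lemma ordS_pred_neq (x : 'I_k) : ordS x != ord_pred x.
Proof.
have lt_x := ltn_ord x.
by rewrite -val_eqE [\val (ordS x)]ordS_val [\val (ord_pred x)]ord_pred_val; case: ifP; case: ifP;
  lia.
Qed.

Lemma sdeg_cycle (S : {set cycle_graph k}) x : sdeg S x = ((ordS x \in S) + (ord_pred x \in S))%N.
Proof.
rewrite /sdeg.
have -> : [set y in S | x -- y] = S :&: [set ordS x; ord_pred x].
  by apply/setP=> y; rewrite !inE /= cycle_edge.
rewrite setIUr cardsU -!setIA.
have -> : [set ordS x] :&: (S :&: [set ord_pred x]) = set0.
  by apply/setP => y; rewrite !inE; apply/negP => /and3P[/eqP-> _];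
    rewrite (negbTE (ordS_pred_neq x)).
rewrite setI0 cards0 subn0.
have card1 y : #|S :&: [set y]| = (y \in S).
  case: (boolP (y \in S)) => yS; first by rewrite (setIidPr _) ?cards1 ?sub1set.
  by apply/eqP; rewrite cards_eq0; apply/eqP/setP=> z; rewrite !inE;
    apply/negP=> /andP[+ /eqP zy]; rewrite zy (negbTE yS).
by rewrite !card1.
Qed.

Definition cyclic_no111 (s : bitseq) := no111 (s ++ take 2 s).

Lemma nth_cyclic S (y : 'I_k) j : (j < k + 2)%N -> j = y %[mod k] ->
  nth false (bits S ++ take 2 (bits S)) j = (y \in S).
Proof.
have lt_y := ltn_ord y; rewrite (modn_small lt_y) => lt_j jy.
rewrite nth_cat size_bits; case: ltnP => [lt_jk|le_kj].
  by rewrite -nth_bits -jy modn_small.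
have lt_jk : (j - k < 2)%N by lia.
have {}jy : (j - k)%N = y by rewrite -jy -[in RHS](subnK le_kj) modnDr modn_small //; lia.
by rewrite nth_take // jy nth_bits.
Qed.

Lemma ordS_mod (x : 'I_k) j : j = x %[mod k] -> j.+1 = ordS x %[mod k].
Proof. by move=> E; rewrite /= modn_mod -(addn1 j) -modnDml E modnDml addn1. Qed.

Lemma nth_cyclic3 S (x : 'I_k) : let s := bits S ++ take 2 (bits S) in
  [/\ nth false s x = (x \in S), nth false s x.+1 = (ordS x \in S)
    & nth false s x.+2 = (ordS (ordS x) \in S)].
Proof.
have lt_x := ltn_ord x; split; apply: nth_cyclic; try by [lia | do ?apply: ordS_mod].
Qed.

Lemma dissociation_cycle (S : {set cycle_graph k}) : dissociation S = cyclic_no111 (bits S).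
Proof.
apply/dissociationP/no111P => [D i|N x xS].
  (* For i >= k the third position lies beyond the k + 2 bits, where the default is false. *)
  have [le_ki|lt_ik] := leqP k i.
    by rewrite [X in [&& _, _ & X]]nth_default ?andbF // size_cat size_take size_bits /=; lia.
  have [/= -> -> ->] := nth_cyclic3 S (Ordinal lt_ik).
  apply/negP=> /and3P[xS SxS SSxS]; have := D _ SxS.
  by rewrite sdeg_cycle SSxS ordSK xS.
have := N (ord_pred x); have [-> -> ->] := nth_cyclic3 S (ord_pred x).
by rewrite ord_predK xS sdeg_cycle; case: (_ \in S) => //=; case: (_ \in S).
Qed.

Definition cycle0 : pgraph := @PGraph (cycle_graph k) ord0.

Lemma outS_cycle (S : {set cycle0}) :
  outS S = cyclic_no111 (bits S) && ~~ nth false (bits S) 0.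
Proof. by rewrite /outS dissociation_cycle (nth_bits S ord0). Qed.

Lemma sdeg_cycle0 (S : {set cycle0}) :
  sdeg S (point cycle0) = (nth false (bits S) 1 + nth false (bits S) m.+3)%N.
Proof.
by rewrite sdeg_cycle -!nth_bits ordS_val ord_pred_val.
Qed.

Lemma isoS_cycle (S : {set cycle0}) : isoS S =
  [&& cyclic_no111 (bits S), nth false (bits S) 0 & ~~ nth false (bits S)
    1 && ~~ nth false (bits S) m.+3].
Proof.
rewrite /isoS dissociation_cycle sdeg_cycle0 (nth_bits S ord0).
by case: (nth _ _ 1); case: (nth _ _ _).
Qed.

Lemma matS_cycle (S : {set cycle0}) : matS S =
  [&& cyclic_no111 (bits S), nth false (bits S) 0 & nth false (bits S) 1 (+) nth false (bits S)
    m.+3].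
Proof.
rewrite /matS dissociation_cycle sdeg_cycle0 (nth_bits S ord0).
by case: (nth _ _ 1); case: (nth _ _ _).
Qed.

Lemma cyclic_false s : cyclic_no111 (false :: s) = no111 s.
Proof.
by case: s => // a s; rewrite -[RHS](no111_false_any _ a) /cyclic_no111 /= take0.
Qed.

(** Neither the leading 10 nor the final appended 0 can be part of a run 111; what remains is the
    tail followed by the repeated first bit. *)
Lemma cyclic_true_false s b :
  cyclic_no111 [:: true, false & rcons s b] = no111 (s ++ [:: b; true]).
Proof.
have tf u : no111 [:: true, false & u] = no111 u by [].
rewrite /cyclic_no111 [take _ _]/= take0 !cat_cons tf cat_rcons.
by rewrite -[RHS]no111_rcons_false -cats1 -catA.
Qed.

Lemma cyclic_true_true s : cyclic_no111 [:: true, true & rcons s false] = no111 [:: true, true & s].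
Proof.
rewrite /cyclic_no111 [take _ _]/= take0 !cat_cons cat_rcons.
by rewrite -[RHS](no111_false_any2 _ true true).
Qed.

Lemma no111_tail s : no111 (rcons s false ++ [:: true; true]) = no111 s.
Proof. by rewrite cat_rcons no111_false_any2. Qed.

Lemma no111_tail' s : no111 (rcons s true ++ [:: true; true]) = false.
Proof.
by elim: s => //= a s ->; rewrite andbF.
Qed.

Lemma bit_polyS n P : bit_poly n.+1 P = 'X * bit_poly n (fun s => P (true :: s))
  + bit_poly n (fun s => P (false :: s)).
Proof. by []. Qed.

Lemma out_poly_cycle : size_poly_of (@outS cycle0) = bit_poly m.+3 no111.
Proof.
apply: etrans (size_poly_bits (Q := (fun s => cyclic_no111 s && ~~ nth false s 0)) outS_cycle) _.
rewrite (bit_polyS m.+3) [X in _ * X + _]bit_poly0 ?mulr0 ?add0r => [|s _];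
  last by rewrite /= andbF.
by apply: eq_bit_poly => s _; rewrite /= andbT cyclic_false.
Qed.

Lemma nth_rcons_size m' (s : bitseq) b : size s = m' -> nth false (rcons s b) m' = b.
Proof. by move=> <-; rewrite nth_rcons ltnn eqxx. Qed.

Lemma iso_poly_cycle : size_poly_of (@isoS cycle0) = 'X * bit_poly m.+1 no111.
Proof.
apply: etrans (size_poly_bits (Q := (fun s => [&& cyclic_no111 s,
  nth false s 0 & ~~ nth false s 1 && ~~ nth false s m.+3])) isoS_cycle) _.
rewrite (bit_polyS m.+3) [X in _ + X]bit_poly0 ?addr0 => [|s _]; last by rewrite /= andbF.
congr (_ * _); rewrite bit_polyS [X in _ * X + _]bit_poly0 ?mulr0 ?add0r => [|s _];
  last by rewrite /= !andbF.
rewrite bit_poly_rcons [X in _ * X + _]bit_poly0 ?mulr0 ?add0r => [|s sz]; last first.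
  by rewrite /= nth_rcons_size // !andbF.
apply: eq_bit_poly => s sz; rewrite /= nth_rcons_size // !andbT cyclic_true_false.
exact: no111_false_any.
Qed.

Lemma mat_poly_cycle : size_poly_of (@matS cycle0) = 'X^2 * (bit_poly m no111 + bit_poly m no111).
Proof.
apply: etrans (size_poly_bits (Q := (fun s => [&& cyclic_no111 s,
  nth false s 0 & nth false s 1 (+) nth false s m.+3])) matS_cycle) _.
rewrite (bit_polyS m.+3) [X in _ + X]bit_poly0 ?addr0 => [|s _]; last by rewrite /= andbF.
rewrite expr2 -mulrA; congr (_ * _); rewrite bit_polyS [RHS]mulrDr; congr (_ + _).
  congr (_ * _); rewrite bit_poly_rcons [X in _ * X + _]bit_poly0 ?mulr0 ?add0r => [|s sz];
    last first.
    by rewrite /= nth_rcons_size // andbF.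
  rewrite (eq_bit_poly (Q := fun s => no111 [:: true, true & s])) => [|s sz]; last first.
    by rewrite /= nth_rcons_size // andbT cyclic_true_true.
  by rewrite bit_polyS [X in _ * X + _]bit_poly0 ?mulr0 ?add0r.
rewrite bit_poly_rcons [X in _ + X]bit_poly0 ?addr0 => [|s sz];
  last by rewrite /= nth_rcons_size // andbF.
congr (_ * _); rewrite (eq_bit_poly (Q := fun s => no111 (s ++ [:: true; true]))) => [|s sz];
  last first.
  by rewrite /= nth_rcons_size // andbT cyclic_true_false.
rewrite bit_poly_rcons [X in _ * X + _]bit_poly0 ?mulr0 ?add0r => [|s sz]; last exact: no111_tail'.
by apply: eq_bit_poly => s sz; apply: no111_tail.
Qed.

End Cycle.

(** Avoiding the point leaves a path of order 3t + 1, with t + 1 sets. Isolating it excludes both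
    neighbours and leaves order 3(t - 1) + 2, with one set. Matching it to one of two neighbours
    excludes two more vertices and leaves order 3(t - 1) + 1, with t sets each. All have size 2t +
    1. *)
Lemma realizes_cycle t (c : cycle_graph (3 * t + 2)) : (0 < t)%N ->
  exists d, realizes (PGraph c) (Profile Level t.+1 1 (2 * t)) d.
Proof.
case: t c => // t c _.
have kE : (3 * t.+1 + 2 = (3 * t).+1.+4)%N by lia.
move: c; rewrite kE => c; exists (2 * t.+1).+1.
apply: realizes_iso (cycle_rotation ord0 c) _.
have [e [_ t1 _]] := top_no111 t.+1; have [e' [_ t1' t2']] := top_no111 t.
rewrite /realizes !addn0 out_poly_cycle iso_poly_cycle mat_poly_cycle; split.
- by have -> : (3 * t).+1.+3 = (3 * t.+1).+1 by lia.
- by rewrite mulnS; apply: topX_mul.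
- rewrite exprS expr1 -mulrA mulnS; do 2!apply: topX_mul.
  by apply: (topD_eq t1' t1'); lia.
Qed.

End GeneratingPolynomials.

(** * Decomposition of potted graphs *)

Section Induced.
Variables (G : sgraph) (A : {set G}).
Definition induced_rel : rel {x : G | x \in A} := fun x y => val x -- val y.
Lemma induced_sym : symmetric induced_rel.
Proof. by move=> x y; apply: sedge_sym. Qed.
Lemma induced_irrefl : irreflexive induced_rel.
Proof. by move=> x; apply: sedge_irrefl. Qed.
Definition induced := SGraph induced_sym induced_irrefl.
End Induced.

Lemma card_induced (G : sgraph) (A : {set G}) : #|induced A| = #|A|.
Proof. by rewrite card_sig; apply: eq_card => x; rewrite inE. Qed.

Definition del (G : sgraph) (x y : G) : rel G := fun a b =>
  a -- b && ~~ ((a == x) && (b == y) || (a == y) && (b == x)).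

Lemma del_sym (G : sgraph) (x y : G) : symmetric (del x y).
Proof. by move=> a b; rewrite /del sedge_sym orbC ![(_ == x) && _]andbC. Qed.

Lemma homo_connect (A B : finType) (f : A -> B) (e : rel A) (e' : rel B) x y :
  (forall a b, e a b -> e' (f a) (f b)) -> connect e x y -> connect e' (f x) (f y).
Proof.
move=> fe /connectP[p + ->]; elim: p x => [|z p IH] x /=; first by rewrite connect0.
by case/andP=> /fe xz /IH; apply: connect_trans (connect1 xz).
Qed.

Lemma connect_induced (G : sgraph) (A : {set G}) (e : rel G) x y (xA : x \in A) (yA : y \in A) :
  subrel e sedge -> (forall a b, a \in A -> e a b -> b \in A) -> connect e x y ->
  connect (@sedge (induced A)) (exist _ x xA) (exist _ y yA).
Proof.
move=> sub_e eA /connectP[p + yE]; elim: p x xA yE => [|z p IH] x xA /= yE.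
  by move=> _; rewrite [exist _ y yA](_ : _ = exist _ x xA) ?connect0 //; apply: val_inj.
case/andP=> xz zp; have zA := eA _ _ xA xz.
by apply: connect_trans (connect1 _) (IH z zA yE zp); apply: sub_e xz.
Qed.

Section Bridge.
Variables (G : sgraph) (v u : G).
Hypotheses (G_conn : connected G) (vu : v -- u) (bridge : ~~ connect (del v u) v u).
Let side := [set x | connect (del v u) v x].

Lemma side_v : v \in side. Proof. by rewrite inE connect0. Qed.
Lemma side_u : u \in ~: side. Proof. by rewrite !inE. Qed.

Lemma conn_del_sym : connect_sym (del v u).
Proof. exact: sym_connect_sym (@del_sym _ _ _). Qed.

Lemma side_del a b : a \in side -> del v u a b -> b \in side.
Proof. by rewrite !inE => va ab; apply: connect_trans va (connect1 ab). Qed.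

Lemma coside_del a b : a \in ~: side -> del v u a b -> b \in ~: side.
Proof. by rewrite !inE => Nva ab; apply: contra Nva => /connect_trans; apply;
  rewrite conn_del_sym connect1. Qed.

(** The vertices reachable from v or from u without the bridge form a set closed under all edges,
    hence everything by connectedness. *)
Lemma coside_conn x : x \in ~: side -> connect (del v u) u x.
Proof.
rewrite !inE => Nvx; suff /orP[vx|//] : x \in [pred x | connect (del v u)
  v x || connect (del v u) u x].
  by rewrite vx in Nvx.
pose S := [pred x | connect (del v u) v x || connect (del v u) u x].
suff cl : closed sedge S by rewrite -(closed_connect cl (G_conn v x)) inE connect0.
apply: intro_closed; first exact: sym_connect_sym (@sedge_sym G).
move=> a b ab; rewrite !inE; have [ab'|] := boolP (del v u a b).
  by case/orP=> /connect_trans/(_ (connect1 ab'))->; rewrite ?orbT.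
rewrite /del ab negbK => /orP[] /andP[_ /eqP->] _; by rewrite connect0 ?orbT.
Qed.

Lemma side_edge a b : a \in side -> b \in ~: side -> a -- b = (a == v) && (b == u).
Proof.
move=> aS bS; apply/idP/andP => [ab|[/eqP-> /eqP->] //].
have [ab'|] := boolP (del v u a b); first by have := side_del aS ab'; rewrite inE in bS;
  rewrite (negbTE bS).
rewrite /del ab negbK => /orP[/andP[] //|/andP[_ /eqP bv]].
by move: bS; rewrite bv inE side_v.
Qed.

Definition side_graph : pgraph := @PGraph (induced side) (exist _ v side_v).
Definition coside_graph : pgraph := @PGraph (induced (~: side)) (exist _ u side_u).

Lemma del_sedge : subrel (del v u) sedge. Proof. by move=> a b /andP[]. Qed.

Lemma side_connected : connected side_graph.
Proof.
move=> [x xS] [y yS]; apply: (connect_induced _ _ del_sedge side_del).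
by move: xS yS; rewrite !inE conn_del_sym; apply: connect_trans.
Qed.

Lemma coside_connected : connected coside_graph.
Proof.
move=> [x xS] [y yS]; apply: (connect_induced _ _ del_sedge coside_del).
by move: (coside_conn xS) (coside_conn yS); rewrite conn_del_sym; apply: connect_trans.
Qed.

Lemma bridge_plink : pisomorphic (plink side_graph coside_graph) (PGraph v).
Proof.
apply: (@plinkP side_graph coside_graph (PGraph v) sval sval) => //; try exact: val_inj.
- by move=> [x xS] [y yS] /= xy; move: yS; rewrite -xy inE xS.
- move=> z; have [zS|zS] := boolP (z \in side); first by left; exists (exist _ z zS).
  by right; have zS' : z \in ~: side by [rewrite inE]; exists (exist _ z zS').
- by move=> [x xS] [y yS]; rewrite /= side_edge // -!val_eqE.
Qed.

End Bridge.

(* [r] is embedded in [G] so that every edge outside its image is a bridge and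
   the image is left only through the point; it is a single vertex or the cycle.
   Cutting a bridge at the point splits off one hanging tree. *)
Lemma decompose n (r : pgraph) (G : sgraph) (f : r -> G) :
  connected r -> #|G| <= n -> connected G -> injective f ->
  (forall x y, f x -- f y = x -- y) ->
  (forall x y, x != point r -> f x -- y -> y \in codom f) ->
  (forall x y, x -- y -> ~~ ((x \in codom f) && (y \in codom f)) -> ~~ connect (del x y) x y) ->
  exists L, pisomorphic (PGraph (f (point r))) (graft r L).
Proof.
elim: n r G f => [|n IH] r G f r_conn leGn G_conn f_inj fE f_closed f_bridge.
  by move: leGn; rewrite leqn0 => /eqP/card0_eq/(_ (f (point r))).
pose v := f (point r).
(* If no edge at v leaves the image of [r], then none leaves it anywhere, and by connectedness [r]
   is the whole graph. *)
have [/existsP[u /andP[vu Nu]]|] := boolP [exists u, (v -- u) && (u \notin codom f)]; last first.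
  move/existsPn => closed_v; exists [::]; apply: pisomorphic_sym.
  exists f; split=> //; apply: inj_surj_bij => // y.
  suff /codomP[x ->] : y \in codom f by exists x.
  suff cl : closed sedge [pred z in codom f].
    by have := closed_connect cl (G_conn v y); rewrite !inE codom_f => <-.
  apply: intro_closed; first exact: sym_connect_sym (@sedge_sym G).
  move=> a b ab /codomP[x aE]; rewrite {}aE in ab.
  have [xr|Nxr] := eqVneq x (point r); last exact: f_closed ab.
  by have := closed_v b; rewrite /v -xr ab negbK.
have bridge : ~~ connect (del v u) v u by apply: f_bridge; rewrite // (negbTE Nu) andbF.
have f_side x : f x \in [set x | connect (del v u) v x].
  rewrite inE; apply: (homo_connect (e := sedge)) (r_conn _ _) => a b ab.
  rewrite /del fE ab /=; apply/negP => /orP[] /andP[/eqP aE /eqP bE].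
    by rewrite -bE codom_f in Nu.
  by rewrite -aE codom_f in Nu.
pose f1 x : side_graph v u := exist _ (f x) (f_side x).
pose f2 (_ : K1) : coside_graph bridge := point (coside_graph bridge).
have val_codom x : (x \in codom f1) = (val x \in codom f).
  apply/codomP/codomP => [[y ->]|[y xE]]; first by exists y.
  by exists y; apply: val_inj.
have del_val (S : {set G}) (x y : induced S) : connect (del x y) x y -> connect (del (val x)
  (val y)) (val x) (val y).
  by apply: homo_connect => a b /andP[ab N]; rewrite /del !(inj_eq val_inj); apply/andP.
have [|||||||L1 iso1] := IH r (side_graph v u) f1 => //.
- rewrite -ltnS; apply: leq_trans leGn; rewrite card_induced -cardsT.
  by apply: proper_card; rewrite properE subsetT; apply/subsetPn; exists u => //; rewrite inE.
- exact: side_connected.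
- by move=> x y /(congr1 val) /f_inj.
- by move=> x y Nx xy; rewrite val_codom; apply: f_closed Nx xy.
- move=> x y xy; rewrite !val_codom => /(f_bridge _ _ xy); apply: contra; exact: del_val.
(* The far side of the bridge has no part of the core, so it is decomposed over a single vertex: it
   is a tree rooted at u. *)
have [|||||||L2 iso2] := IH K1 (coside_graph bridge) f2 => //.
- by move=> x y; rewrite [x]ord1 [y]ord1 connect0.
- rewrite -ltnS; apply: leq_trans leGn; rewrite card_induced -cardsT.
  by apply: proper_card; rewrite properE subsetT; apply/subsetPn; exists v => //;
    rewrite !inE connect0.
- exact: coside_connected.
- by move=> x y _; rewrite [x]ord1 [y]ord1.
- by move=> x y; rewrite [x]ord1 [y]ord1 !sedge_irrefl.
- by move=> x y; rewrite [x]ord1.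
- move=> x y xy _; have Nx : val x \notin codom f.
    apply/negP=> /codomP[z xE]; have := f_side z; rewrite -xE => xS.
    by have := valP x; rewrite in_setC xS.
  have := f_bridge _ _ xy; rewrite (negbTE Nx) => /(_ isT); apply: contra; exact: del_val.
exists (plant L2 :: L1); apply: pisomorphic_trans (pisomorphic_sym (bridge_plink vu bridge)) _.
apply: plink_congr; last by rewrite interp_plant.
rewrite (_ : side_graph v u = PGraph (f1 (point r))) //; congr PGraph; exact: val_inj.
Qed.

(** * The cycle of a potted graph *)

Definition cycle_edges (G : sgraph) (c : seq G) : {set {set G}} :=
  [set [set x; next c x] | x in c].

Lemma cover_cycle_edges (G : sgraph) (c : seq G) x : (x \in cover (cycle_edges c)) = (x \in c).
Proof.
apply/bigcupP/idP => [[_ /imsetP[y yc ->]]|xc].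
  by rewrite !inE => /orP[] /eqP-> //; rewrite mem_next.
by exists [set x; next c x]; [apply: imset_f|rewrite !inE eqxx].
Qed.

Lemma cycle_nth (T : eqType) (e : rel T) v p i : cycle e (v :: p) -> i < (size p).+1 ->
  e (nth v (v :: p) i) (nth v (v :: p) (i.+1 %% (size p).+1)).
Proof.
move=> /= /(pathP v) H lt_i; have := H i; rewrite size_rcons => /(_ lt_i).
have nth_p j : nth v (rcons p v) j = nth v p j.
  rewrite nth_rcons; case: ltngtP => // [lt_j|->]; last by rewrite nth_default.
  by rewrite nth_default // ltnW.
rewrite -rcons_cons nth_rcons /= lt_i nth_p.
have [lt_p|ge_p] := ltnP i (size p); first by rewrite modn_small.
have -> : i.+1 = (size p).+1 by lia.
by rewrite modnn [nth v p i]nth_default.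
Qed.

Section Potted.
Variables (G : sgraph) (C : {set {set G}}) (v : G) (p : seq G) (m : nat).
Hypotheses (G_conn : connected G) (C_uniq : forall C', is_cycle C' -> C' = C).
Hypotheses (vp_cycle : ucycle sedge (v :: p)) (vp_size : size p = m.+3).
Hypothesis (C_cover : forall x, (x \in cover C) = (x \in v :: p)).
Hypothesis (v_uniq : forall x, x \in v :: p -> 2 < degree x -> x = v).

Let f (i : cycle_graph m.+4) : G := nth v (v :: p) i.

Lemma around_inj : injective f.
Proof.
have /andP[_ up] := vp_cycle => i j /eqP; rewrite nth_uniq // => [/eqP/ord_inj //||];
by rewrite /= vp_size.
Qed.

Lemma around_ordS i : f i -- f (ordS i).
Proof.
have /andP[cy _] := vp_cycle.
by have := @cycle_nth _ _ v p i cy; rewrite vp_size; apply.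
Qed.

Lemma around_ord_pred i : f i -- f (ord_pred i).
Proof. by have := around_ordS (ord_pred i); rewrite ord_predK sedge_sym. Qed.

Lemma around_mem i : f i \in v :: p.
Proof. by apply: mem_nth; rewrite /= vp_size. Qed.

Lemma around_surj x : x \in v :: p -> exists i, f i = x.
Proof.
move=> xp; have := xp; rewrite -index_mem /= vp_size => lt_i.
by exists (Ordinal lt_i); rewrite /f /= nth_index.
Qed.

Lemma codom_around x : (x \in codom f) = (x \in v :: p).
Proof.
apply/codomP/idP => [[i ->]|/around_surj[i <-]]; [exact: around_mem|by exists i].
Qed.

(** [f ord0] is v, the only cycle vertex of degree above 2; at any other, the two distinct cyclic
    neighbours already exhaust the neighbourhood. *)
Lemma around_nbr i y : i != ord0 -> f i -- y -> y = f (ordS i) \/ y = f (ord_pred i).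
Proof.
move=> Ni iy; have deg : degree (f i) <= 2.
  rewrite leqNgt; apply: contra Ni => /(v_uniq (around_mem i)) fiv.
  by apply/eqP/around_inj; rewrite fiv.
have sub : [set f (ordS i); f (ord_pred i)] \subset [set z | f i -- z].
  by apply/subsetP=> z; rewrite !inE => /orP[] /eqP->; rewrite ?around_ordS ?around_ord_pred.
have E : [set f (ordS i); f (ord_pred i)] = [set z | f i -- z].
  by apply/eqP; rewrite eqEcard sub cards2 (inj_eq around_inj) ordS_pred_neq.
have : y \in [set f (ordS i); f (ord_pred i)] by rewrite E inE.
by rewrite !inE => /orP[] /eqP->; [left|right].
Qed.

(** There are no chords: one of two adjacent vertices is not v, and [around_nbr] applies to it. *)
Lemma around_edge i j : f i -- f j = i -- j.
Proof.
rewrite /= cycle_edge; apply/idP/orP => [ij|[] /eqP->];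
  [|exact: around_ordS|exact: around_ord_pred].
have [i0|Ni] := eqVneq i ord0; last by case: (around_nbr Ni ij) => /around_inj->; [left|right].
have [j0|Nj] := eqVneq j ord0; first by rewrite i0 j0 sedge_irrefl in ij.
rewrite sedge_sym in ij.
by case: (around_nbr Nj ij) => /around_inj->; rewrite ?ordSK ?ord_predK; [right|left].
Qed.

Lemma cycle_connected : connected (cycle_graph m.+4).
Proof.
have to0 (i : cycle_graph m.+4) : connect sedge (ord0 : cycle_graph m.+4) i.
  case: i => i lt_i; elim: i lt_i => [|i IH] lt_i.
    by rewrite (_ : Ordinal lt_i = ord0) ?connect0 //; apply: ord_inj.
  apply: connect_trans (IH (ltnW lt_i)) (connect1 _); rewrite /= cycle_edge.
  by apply/orP; left; apply/eqP/ord_inj; rewrite /= modn_small.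
by move=> i j; apply: connect_trans (to0 j);
  rewrite (sym_connect_sym (@sedge_sym (cycle_graph m.+4))).
Qed.

(** A path from x to y avoiding the edge xy closes up to a cycle through both ends; this cycle must
    be C. *)
Lemma around_bridge x y : x -- y -> ~~ ((x \in codom f) && (y \in codom f))
  -> ~~ connect (del x y) x y.
Proof.
move=> xy; rewrite !codom_around; apply: contraNN => /connectP[q0 q0P].
case/shortenP: q0P => q qP q_uniq _ yE {q0}.
have sz : 2 < size (x :: q).
  case: q qP yE {q_uniq} => [_ yE|y' [|//]]; first by rewrite yE sedge_irrefl in xy.
  by rewrite /= andbT => + yE; rewrite -yE /del !eqxx andbF.
have xq_cycle : ucycle sedge (x :: q).
  rewrite /ucycle q_uniq andbT /= rcons_path -yE sedge_sym xy andbT.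
  by apply: sub_path qP => a b /andP[].
have CE : cycle_edges (x :: q) = C by apply: C_uniq; exists (x :: q).
by rewrite -!C_cover -CE !cover_cycle_edges mem_head yE mem_last.
Qed.

Lemma potted_decompose :
  exists L, pisomorphic (PGraph v) (graft (@PGraph (cycle_graph m.+4) ord0) L).
Proof.
apply: (@decompose #|G| (@PGraph (cycle_graph m.+4) ord0) G f) => //.
- exact: cycle_connected.
- exact: around_inj.
- exact: around_edge.
- by move=> x y Nx /(around_nbr Nx) [] ->; rewrite codom_around around_mem.
- exact: around_bridge.
Qed.
End Potted.

Lemma potted_graft n k G : 3 < k -> potted_order n k G ->
  exists (c : cycle_graph k) L, isomorphic G (graft (PGraph c) L).
Proof.
move=> k3 [[[G_conn [C [C_cycle C_uniq]]] pot] _ Ck].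
have [c [c_cycle c_size CE]] := C_cycle.
have [v [[vC _] v_uniq]] := pot C C_cycle.
have coverE x : (x \in cover C) = (x \in c) by rewrite CE cover_cycle_edges.
have c_k : size c = k.
  rewrite -(Ck C C_cycle) (eq_card coverE); apply/esym/card_uniqP.
  by case/andP: c_cycle.
have [i p pE] : rot_to_spec c v by apply: rot_to; rewrite -coverE.
case: k k3 c_k {Ck} => [|[|[|[|m]]]] // _ c_k.
have [|||||L L_iso] := @potted_decompose G C v p m G_conn.
- by move=> C' /C_uniq.
- by rewrite -pE rot_ucycle.
- by apply: succn_inj; rewrite -[LHS]/(size (v :: p)) -pE size_rot.
- by move=> x; rewrite coverE -pE mem_rot.
- by move=> x xp dx; apply/esym/v_uniq; rewrite coverE -(mem_rot i) pE.
by exists ord0, L; apply: pisomorphicW L_iso.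
Qed.

Lemma card_interp T : #|interp T| = order T.
Proof. by elim: T => [|X IHX Y IHY] /=; rewrite ?card_ord // card_sum IHX IHY. Qed.

Lemma card_graft p L : #|graft p L| = orders L + #|p|.
Proof.
by rewrite /orders; elim: L => //= T L IH; rewrite card_sum IH card_interp; lia.
Qed.

Lemma num_max_dissociation_graft t (c : cycle_graph (3 * t + 2)) L G : 0 < t ->
  isomorphic G (graft (PGraph c) L) -> num_max_dissociation G = ptotal (potted_profile t L).
Proof.
move=> t0 GL; have [d cd] := realizes_cycle c t0; have [e Le] := realizes_graft L cd.
exact: num_max_dissociation_iso GL (potted_profile_pos _ _) (realizes_total Le).
Qed.

Theorem theorem1p2 (n k : nat) (n_gt0 : 0 < n) (k_gt0 : 0 < k)
    (le_k3_n : k + 3 <= n) (k_mod3 : k = 2 %[mod 3])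
    (G : sgraph) (G_potted : potted_order n k G) :
  num_max_dissociation G <= dissociation_bound n k /\
  (num_max_dissociation G = dissociation_bound n k <->
   [\/ n = 0 %[mod 3] /\
         (family_G2 k G /\ x1 n k = maxn (x1 n k) (x2 n k) \/
          family_G9 k G /\ x2 n k = maxn (x1 n k) (x2 n k)),
       n = 1 %[mod 3] /\ (family_G6 k G \/ family_G7 k G)
     | n = 2 %[mod 3] /\
         (family_G1 k G /\ x3 n k = maxn (x3 n k) (x4 n k) \/
          family_G8 k G /\ x4 n k = maxn (x3 n k) (x4 n k))]).
Proof.
(* A cycle has at least three vertices; this rules out k = 2 and gives t > 0. *)
have k2 : 2 < k.
  have [[[_ [C [C_cycle _]]] _] _ Ck] := G_potted.
  have [c [/andP[_ c_uniq] c_size CE]] := C_cycle.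
  rewrite -(Ck C C_cycle) (eq_card (B := mem c)) ?(card_uniqP c_uniq) //.
  by move=> x; rewrite CE cover_cycle_edges.
have [t kE] : exists t, k = 3 * t + 2 by exists (k %/ 3); lia.
have t0 : 0 < t by lia.
move: G_potted le_k3_n {k_gt0 k_mod3 k2}; rewrite {k}kE => G_potted le_n.
have [|c [L GL]] := potted_graft _ G_potted; first by lia.
(* Stated for every forest, since membership in a family yields a grafting that need not be the one
   found by the decomposition. *)
have mG L' : isomorphic G (graft (PGraph c) L') ->
    num_max_dissociation G = ptotal (potted_profile t L') /\ n = orders L' + (3 * t + 2).
  move=> GL'; split; first exact: num_max_dissociation_graft GL'.
  have [_ <- _] := G_potted; have [f [f_bij _]] := GL'.
  by rewrite (bij_eq_card f_bij) card_graft card_ord.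
set k := 3 * t + 2 in G_potted c GL mG le_n *.
have [mE nE] := mG L GL; rewrite mE.
have N3 : 3 <= orders L by lia.
have val1 : family_G1 k G -> num_max_dissociation G = x3 n k.
  by move/(family_G1P _ c) => [L' /(extremal1_value t) + /mG[-> ->]].
have val2 : family_G2 k G -> num_max_dissociation G = x1 n k.
  by move/(family_G2P _ c) => [L' /(extremal2_value t) + /mG[-> ->]].
have val6 : family_G6 k G -> num_max_dissociation G = dissociation_bound n k.
  by move/(family_G6P _ c) => [L' /(extremal6_value t) + /mG[-> ->]].
have val7 : family_G7 k G -> num_max_dissociation G = dissociation_bound n k.
  by move/(family_G7P _ c) => [L' /(extremal7_value t) + /mG[-> ->]].
have val8 : family_G8 k G -> num_max_dissociation G = x4 n k.
  by move/(family_G8P _ c) => [L' /(extremal8_value t) + /mG[-> ->]].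
have val9 : family_G9 k G -> num_max_dissociation G = x2 n k.
  by move/(family_G9P _ c) => [L' /(extremal9_value t) + /mG[-> ->]].
rewrite mE in val1 val2 val6 val7 val8 val9.
have bound0 : n %% 3 = 0 -> dissociation_bound n k = maxn (x1 n k) (x2 n k).
  by rewrite /dissociation_bound => ->.
have bound2 : n %% 3 = 2 -> dissociation_bound n k = maxn (x3 n k) (x4 n k).
  by rewrite /dissociation_bound => ->.
(* As k is 2 modulo 3, the residues 0, 1, 2 of the order of the forest correspond to the residues 2,
   0, 1 of n. *)
have main := potted_profile_extremal t0 N3; rewrite /= -/k -nE in main.
split.
  case: main => [/ltnW //|[[N0 [] [_ ->]]|[N1 [] [_ ->]]|[_ [_ ->]]]] //.
  - by rewrite bound2 ?leq_maxr //; lia.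
  - by rewrite bound2 ?leq_maxl //; lia.
  - by rewrite bound0 ?leq_maxr //; lia.
  - by rewrite bound0 ?leq_maxl //; lia.
split; last first.
  case=> [[n0 []]|[_ []]|[n2 []]].
  - by case=> /val2-> x1E; rewrite bound0.
  - by case=> /val9-> x2E; rewrite bound0.
  - exact: val6.
  - exact: val7.
  - by case=> /val1-> x3E; rewrite bound2.
  - by case=> /val8-> x4E; rewrite bound2.
move=> mB; case: main => [|[[N0 [] [extL mx]]|[N1 [] [extL mx]]|[N2 [extL _]]]].
- by rewrite mB ltnn.
- have n2 : n %% 3 = 2 by lia.
  constructor 3; split=> //; right; split; last by rewrite -bound2 // -mB mx.
  by apply/(family_G8P _ c); exists L.
- have n2 : n %% 3 = 2 by lia.
  constructor 3; split=> //; left; split; last by rewrite -bound2 // -mB mx.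
  by apply/(family_G1P _ c); exists L.
- have n0 : n %% 3 = 0 by lia.
  constructor 1; split=> //; right; split; last by rewrite -bound0 // -mB mx.
  by apply/(family_G9P _ c); exists L.
- have n0 : n %% 3 = 0 by lia.
  constructor 1; split=> //; left; split; last by rewrite -bound0 // -mB mx.
  by apply/(family_G2P _ c); exists L.
constructor 2; split; first by rewrite nE /k; lia.
by case: extL => extL; [left; apply/(family_G6P _ c)|right; apply/(family_G7P _ c)]; exists L.
Qed.
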